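(* Let $q$ be an odd prime power, $A=\mathbb{F}_q[T]$, $F=\mathbb{F}_q(T)$, and let $\psi: A\to F\{\tau\}$ be a Drinfeld module of rank $2$ over $F$ with $\operatorname{End}_{F^{\mathrm{alg}}}(\psi)=A$. Then there is a constant $C>0$, depending only on $q$ and on the coefficients of $\psi_T\in F\{\tau\}$, such that for every prime $\mathfrak{p}=pA$ of good reduction for $\psi$ (with $p$ the monic generator of $\mathfrak{p}$), $$|d_{2,\mathfrak{p}}|\ \geq\ C\,|p|^{\frac12}\,\frac{(\log|p|)^{\frac12}}{\log\log|p|},$$ where $d_{1,\mathfrak{p}},d_{2,\mathfrak{p}}\in A$ are the unique nonzero monic polynomials with $d_{1,\mathfrak{p}}\mid d_{2,\mathfrak{p}}$ and ${}^{\psi}\mathbb{F}_{\mathfrak{p}}\cong A/d_{1,\mathfrak{p}}A\times A/d_{2,\mathfrak{p}}A$ as $A$-modules.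
   Context: $F^{\mathrm{alg}}$ is a fixed algebraic closure of $F$. A prime of $A$ is a nonzero prime ideal $\mathfrak{p}$ of $A$, and $\mathbb{F}_{\mathfrak{p}}=A/\mathfrak{p}$. An $A$-field is a field $L$ with a ring homomorphism $\gamma:A\to L$ (the natural inclusion if $L\supseteq F$; the natural map $A\to A/\mathfrak{p}\hookrightarrow L$ if $L$ is a finite extension of $\mathbb{F}_{\mathfrak{p}}$). $L\{\tau\}$ is the ring of noncommutative polynomials in $\tau$ with $\tau c=c^q\tau$ for $c\in L$. A Drinfeld module of rank $r\ge 1$ over $L$ is an $\mathbb{F}_q$-algebra homomorphism $\psi:A\to L\{\tau\}$, $a\mapsto\psi_a$, with $\psi_T=\gamma(T)+\sum_{i=1}^r g_i\tau^i$, $g_i\in L$, $g_r\ne0$. For $L'\supseteq L$, $\operatorname{End}_{L'}(\psi)=\{u\in L'\{\tau\}: u\psi_a=\psi_a u\ \forall a\in A\}$; it contains $\psi(A)\cong A$, and $\operatorname{End}_{F^{\mathrm{alg}}}(\psi)=A$ means that it equals $\psi(A)$. For $\psi$ of rank $2$ over $F$ with $\psi_T=T+g_1\tau+g_2\tau^2$, a prime $\mathfrak{p}$ is of good reduction if $\operatorname{ord}_{\mathfrak{p}}(g_1)\ge0$ and $\operatorname{ord}_{\mathfrak{p}}(g_2)=0$; then the reduction $\psi\otimes\mathbb{F}_{\mathfrak{p}}:A\to\mathbb{F}_{\mathfrak{p}}\{\tau\}$ is the rank $2$ Drinfeld module obtained by reducing the coefficients of $\psi_T$ modulo $\mathfrak{p}$.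 Letting $\tau$ act on $\mathbb{F}_{\mathfrak{p}}$ as $\alpha\mapsto\alpha^q$, the field $\mathbb{F}_{\mathfrak{p}}$ becomes an $A$-module on which $a\in A$ acts as $(\psi\otimes\mathbb{F}_{\mathfrak{p}})_a$; this $A$-module is denoted ${}^{\psi}\mathbb{F}_{\mathfrak{p}}$. It is known that it is isomorphic to $A/d_1A\times A/d_2A$ for uniquely determined nonzero monic $d_1\mid d_2$. The absolute value is $|a|=q^{\deg a}$ for $a\in A$. *)

(* Defs.v *)
From HB Require Import structures.
From mathcomp Require Import all_boot all_order all_algebra all_field.

Set Implicit Arguments.
Unset Strict Implicit.
Unset Printing Implicit Defensive.

Import Order.TTheory GRing.Theory Num.Theory.
Local Open Scope ring_scope.
Local Open Scope quotient_scope.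

(* Throughout, k is the finite field F_q (so q = #|k|), A = {poly k} with       *)
(* T = 'X, F = {fraction {poly k}}, and an A-field is a field L together with   *)
(* a ring morphism gamma : {rmorphism {poly k} -> L}.                           *)

Section TwistedPolynomials.
Variables (k : finFieldType) (L : fieldType) (gamma : {rmorphism {poly k} -> L}).
Local Notation q := #|k|.

Fact exprqD i (x y : L) : (x + y) ^+ (q ^ i) = x ^+ (q ^ i) + y ^+ (q ^ i).
Proof.
have [p p_pr pchk] := finPcharP k.
have pchL : p \in [pchar L].
  by apply: (rmorph_pchar (gamma \o polyC)) pchk.
apply: exprDn_pchar; rewrite (card_pprimeChar pchk) -expnM.
by rewrite (eq_pnat _ (pcharf_eq pchL)) pnatX pnat_id.
Qed.

Fact exprq0 i : 0 ^+ (q ^ i) = 0 :> L.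
Proof. by rewrite expr0n eqn0Ngt expn_gt0 (ltnW (finNzRing_gt1 k)). Qed.

Fact exprq_gammaC i (c : k) : gamma c%:P ^+ (q ^ i) = gamma c%:P.
Proof.
rewrite -rmorphXn -polyC_exp; congr (gamma _%:P).
by elim: i => [|i IHi]; rewrite ?expr1 // expnS exprM expf_card.
Qed.

(* The ring L{tau}. An element \sum_i u_i tau^i is stored as the polynomial     *)
(* \sum_i u_i 'X^i, so that u`_i is its i-th coefficient, but the product is    *)
(* the twisted one and F_q acts through gamma.                                  *)
Definition tpoly of {rmorphism {poly k} -> L} := {poly L}.
Local Notation Ltau := (tpoly gamma).

HB.instance Definition _ := GRing.Zmodule.copy Ltau {poly L}.

(* (u_i tau^i) (v_j tau^j) = u_i v_j^(q^i) tau^(i+j) *)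
Definition tmul (u v : Ltau) : Ltau :=
  \sum_(i < size u) \sum_(j < size v) (u`_i * v`_j ^+ (q ^ i)) *: 'X^(i + j).

Let shift i (v : {poly L}) : {poly L} :=
  \sum_(j < size v) v`_j ^+ (q ^ i) *: 'X^(i + j).

Let coef_shift i v n :
  (shift i v)`_n = if (n < i)%N then 0 else v`_(n - i) ^+ (q ^ i).
Proof.
rewrite coef_sum; under eq_bigr do rewrite coefZ coefXn.
case: ltnP => [lt_ni | le_in].
  rewrite big1 // => j _; rewrite ltn_eqF ?mulr0 //.
  by rewrite (leq_trans lt_ni) ?leq_addr.
have [lt_v|le_v] := ltnP (n - i) (size v).
  rewrite (bigD1 (Ordinal lt_v)) //= subnKC // eqxx mulr1 big1 ?addr0 // => j.
  rewrite -val_eqE /= => nj; case: eqP; rewrite ?mulr0 // => nE.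
  by rewrite nE addKn eqxx in nj.
rewrite big1 => [|j _]; first by rewrite (nth_default _ le_v) exprq0.
case: eqP; rewrite ?mulr0 // => nE.
by rewrite nE addKn leqNgt ltn_ord in le_v.
Qed.

Let shiftD i : {morph shift i : u v / u + v}.
Proof.
move=> u v; apply/polyP => n; rewrite coefD !coef_shift coefD.
by case: ifP; rewrite ?addr0 // exprqD.
Qed.

Let shiftZ i c v : shift i (c *: v) = c ^+ (q ^ i) *: shift i v.
Proof.
apply/polyP => n; rewrite coefZ !coef_shift coefZ.
by case: ifP; rewrite ?mulr0 // exprMn.
Qed.

Let shift0 i : shift i 0 = 0.
Proof. by apply/polyP => n; rewrite coef_shift !coef0 exprq0 if_same. Qed.

Let shift_sum i I r (P : pred I) (f : I -> {poly L}) :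
  shift i (\sum_(j <- r | P j) f j) = \sum_(j <- r | P j) shift i (f j).
Proof. exact: (big_morph _ (shiftD i) (shift0 i)). Qed.

Let shift0E v : shift 0 v = v.
Proof. by apply/polyP => n; rewrite coef_shift ltn0 subn0 expr1. Qed.

Let shift_shift i j v : shift i (shift j v) = shift (i + j) v.
Proof.
apply/polyP => n; rewrite !coef_shift.
case: (ltnP n i) => [lt_ni|le_in]; first by rewrite (ltn_addr _ lt_ni).
rewrite ltn_subLR // subnDA; case: ifP => _; first by rewrite exprq0.
by rewrite -exprM -expnD addnC.
Qed.

Let tmulE N (u v : Ltau) :
  (size u <= N)%N -> tmul u v = \sum_(i < N) u`_i *: shift i v.
Proof.
move=> le_uN; transitivity (\sum_(i < size u) u`_i *: shift i v).
  apply: eq_bigr => i _; rewrite scaler_sumr.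
  by apply: eq_bigr => j _; rewrite scalerA.
rewrite (big_ord_widen N (fun i => u`_i *: shift i v) le_uN) big_mkcond /=.
apply: eq_bigr => i _; case: ltnP => // le_ui.
by rewrite nth_default // scale0r.
Qed.

Let tmulDl (u v w : Ltau) : tmul (u + v) w = tmul u w + tmul v w.
Proof.
pose N := maxn (size u) (size v).
rewrite (@tmulE N) ?size_polyD // !(@tmulE N) ?leq_maxl ?leq_maxr //.
by rewrite -big_split; apply: eq_bigr => i _; rewrite /= coefD scalerDl.
Qed.

Let tmulDr (u v w : Ltau) : tmul u (v + w) = tmul u v + tmul u w.
Proof.
rewrite !(@tmulE (size u)) // -big_split.
by apply: eq_bigr => i _; rewrite /= shiftD scalerDr.
Qed.

Let tmulZl c (u v : {poly L}) : tmul (c *: u : Ltau) v = c *: tmul u v.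
Proof.
rewrite (@tmulE (size u)) ?size_scale_leq // (@tmulE (size u)) // scaler_sumr.
by apply: eq_bigr => i _; rewrite coefZ scalerA.
Qed.

Let tmul0l v : tmul 0 v = 0.
Proof. by rewrite /tmul size_poly0 big_ord0. Qed.

Let tmul_suml v I r (P : pred I) (f : I -> {poly L}) :
  tmul (\sum_(j <- r | P j) f j) v = \sum_(j <- r | P j) tmul (f j) v.
Proof.
exact: (big_morph (fun u : {poly L} => tmul u v)
  (fun x y => tmulDl x y v) (tmul0l v)).
Qed.

Let tmul_shift i (v w : {poly L}) : tmul (shift i v) w = shift i (tmul v w).
Proof.
rewrite (@tmulE (i + size v)); last first.
  apply/leq_sizeP => n le_n; rewrite coef_shift.
  case: ltnP => // le_in; rewrite nth_default ?exprq0 //.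
  by rewrite leq_subRL // (leq_trans _ le_n).
rewrite big_split_ord /= big1 => [|j _]; last first.
  by rewrite coef_shift ltn_ord scale0r.
rewrite add0r (@tmulE (size v)) // shift_sum; apply: eq_bigr => j _.
rewrite coef_shift ltnNge leq_addr addKn shiftZ shift_shift //.
Qed.

Fact tmulA : associative tmul.
Proof.
move=> u v w; rewrite (@tmulE (size u) u (tmul v w)) // (@tmulE (size u) u v) //.
rewrite tmul_suml; apply: eq_bigr => i _.
by rewrite tmulZl tmul_shift.
Qed.

Definition tone : Ltau := 1%:P.

Fact tmul1l : left_id tone tmul.
Proof.
move=> v; rewrite (@tmulE 1) ?size_polyC_leq1 //.
by rewrite big_ord1 coefC eqxx scale1r shift0E.
Qed.

Fact tmul1r : right_id tone tmul.
Proof.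
move=> u; rewrite (@tmulE (size u)) // -[RHS](coefK u) poly_def.
apply: eq_bigr => i _; congr (_ *: _); apply/polyP => n.
rewrite coef_shift coefC coefXn subn_eq0.
by case: (ltngtP n i) => // _; rewrite ?exprq0 ?expr1n.
Qed.

Fact tone_neq0 : tone != 0.
Proof. exact: (oner_neq0 {poly L}). Qed.

HB.instance Definition _ := GRing.Zmodule_isNzRing.Build Ltau
  tmulA tmul1l tmul1r tmulDl tmulDr tone_neq0.

Definition tscale (c : k) (u : Ltau) : Ltau := gamma c%:P *: (u : {poly L}).

Fact tscaleA a b u : tscale a (tscale b u) = tscale (a * b) u.
Proof. by rewrite /tscale scalerA polyCM rmorphM. Qed.
Fact tscale1 : left_id 1 tscale.
Proof. by move=> u; rewrite /tscale rmorph1 scale1r. Qed.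
Fact tscaleDr : right_distributive tscale +%R.
Proof. by move=> c u v; rewrite /tscale -scalerDr. Qed.
Fact tscaleDl u : {morph tscale^~ u : a b / a + b}.
Proof. by move=> a b; rewrite /tscale polyCD rmorphD scalerDl. Qed.

HB.instance Definition _ := GRing.Zmodule_isLmodule.Build k Ltau
  tscaleA tscale1 tscaleDr tscaleDl.

Fact tscaleAl (c : k) (u v : Ltau) : c *: (u * v) = (c *: u) * v.
Proof. by symmetry; apply: tmulZl. Qed.

HB.instance Definition _ := GRing.Lmodule_isLalgebra.Build k Ltau tscaleAl.

Fact tscaleAr (c : k) (u v : Ltau) : c *: (u * v) = u * (c *: v).
Proof.
transitivity (gamma c%:P *: tmul u v); first by [].
transitivity (tmul u (gamma c%:P *: (v : {poly L}) : {poly L})); last by [].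
rewrite (@tmulE (size u) u v) // (@tmulE (size u) u (_ *: _)) // scaler_sumr.
apply: eq_bigr => i _; rewrite (shiftZ i (gamma c%:P) v) exprq_gammaC.
by rewrite !scalerA mulrC.
Qed.

HB.instance Definition _ := GRing.Lalgebra_isAlgebra.Build k Ltau tscaleAr.

(* The action of L{tau} on L itself, tau acting as x |-> x ^+ q. *)
Definition teval (u : Ltau) (x : L) : L :=
  \sum_(i < size u) u`_i * x ^+ (q ^ i).

Let tevalE N (u : Ltau) x :
  (size u <= N)%N -> teval u x = \sum_(i < N) u`_i * x ^+ (q ^ i).
Proof.
move=> le_uN; rewrite /teval (big_ord_widen N (fun i => u`_i * x ^+ (q ^ i)) le_uN).
rewrite big_mkcond /=; apply: eq_bigr => i _; case: ltnP => // le_ui.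
by rewrite nth_default // mul0r.
Qed.

Fact tevalDr u : {morph teval u : x y / x + y}.
Proof.
move=> x y; rewrite /teval -big_split; apply: eq_bigr => i _.
by rewrite exprqD mulrDr.
Qed.

Fact tevalDl x : {morph teval^~ x : u v / u + v}.
Proof.
move=> u v; pose N := maxn (size u) (size v).
rewrite (@tevalE N) ?size_polyD // !(@tevalE N) ?leq_maxl ?leq_maxr //.
by rewrite -big_split; apply: eq_bigr => i _; rewrite /= coefD mulrDl.
Qed.

Let teval0l x : teval 0 x = 0.
Proof. by rewrite /teval size_poly0 big_ord0. Qed.

Let tevalZl c (u : {poly L}) x : teval (c *: u : {poly L}) x = c * teval u x.
Proof.
rewrite (@tevalE (size u)) ?size_scale_leq // (@tevalE (size u)) // mulr_sumr.
by apply: eq_bigr => i _; rewrite coefZ mulrA.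
Qed.

Let teval_shift i (v : {poly L}) x :
  teval (shift i v) x = teval v x ^+ (q ^ i).
Proof.
rewrite (@tevalE (i + size v)); last first.
  apply/leq_sizeP => n le_n; rewrite coef_shift.
  case: ltnP => // le_in; rewrite nth_default ?exprq0 //.
  by rewrite leq_subRL // (leq_trans _ le_n).
rewrite big_split_ord /= big1 => [|j _]; last first.
  by rewrite coef_shift ltn_ord mul0r.
rewrite add0r /teval.
rewrite (big_morph (fun y => y ^+ (q ^ i)) (exprqD i) (exprq0 i)).
apply: eq_bigr => j _.
by rewrite coef_shift ltnNge leq_addr addKn exprMn -exprM -expnD addnC.
Qed.

Fact tevalM (u v : Ltau) x : teval (u * v) x = teval u (teval v x).
Proof.
transitivity (teval (tmul u v) x); first by [].
rewrite (@tmulE (size u) u v) // (big_morph (teval^~ x) (tevalDl x) (teval0l x)).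
by apply: eq_bigr => i _; rewrite tevalZl teval_shift.
Qed.

Fact teval1 x : teval 1 x = x.
Proof.
by rewrite (@tevalE 1) ?size_polyC_leq1 // big_ord1 coefC eqxx mul1r expr1.
Qed.

End TwistedPolynomials.

Section DrinfeldModules.
Variables (k : finFieldType) (L : fieldType) (gamma : {rmorphism {poly k} -> L}).

(* phi_T = gamma(T) + g_1 tau + ... + g_r tau^r with g_r != 0 *)
Definition is_Drinfeld (r : nat) (phi : {lrmorphism {poly k} -> tpoly gamma}) :=
  [/\ (0 < r)%N, (phi 'X)`_0 = gamma 'X & size (phi 'X) = r.+1].

(* The A-module carried by L: a acts on x as phi_a. *)
Definition Drinfeld_module of {lrmorphism {poly k} -> tpoly gamma} : Type := L.

Variable phi : {lrmorphism {poly k} -> tpoly gamma}.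
Local Notation M := (Drinfeld_module phi).

HB.instance Definition _ := GRing.Zmodule.copy M L.

Definition Drinfeld_scale (a : {poly k}) (x : M) : M := teval (phi a) x.

Fact Drinfeld_scaleA a b x :
  Drinfeld_scale a (Drinfeld_scale b x) = Drinfeld_scale (a * b) x.
Proof. by rewrite /Drinfeld_scale rmorphM tevalM. Qed.
Fact Drinfeld_scale1 : left_id 1 Drinfeld_scale.
Proof. by move=> x; rewrite /Drinfeld_scale rmorph1 teval1. Qed.
Fact Drinfeld_scaleDr : right_distributive Drinfeld_scale +%R.
Proof. by move=> a x y; apply: tevalDr. Qed.
Fact Drinfeld_scaleDl x : {morph Drinfeld_scale^~ x : a b / a + b}.
Proof. by move=> a b; rewrite /Drinfeld_scale rmorphD tevalDl. Qed.

HB.instance Definition _ := GRing.Zmodule_isLmodule.Build {poly k} M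
  Drinfeld_scaleA Drinfeld_scale1 Drinfeld_scaleDr Drinfeld_scaleDl.

(* The image in L'{tau} of an element of L{tau}, for an extension iota of L. *)
Definition tpoly_ext (L' : fieldType) (iota : {rmorphism L -> L'})
  (u : tpoly gamma) : tpoly (iota \o gamma) := map_poly iota u.

(* End_{L'}(phi) *)
Definition Drinfeld_End (L' : fieldType) (iota : {rmorphism L -> L'})
    (u : tpoly (iota \o gamma)) : Prop :=
  forall a, u * tpoly_ext iota (phi a) = tpoly_ext iota (phi a) * u.

End DrinfeldModules.

Definition is_algebraic_closure (K : fieldType) (Kalg : closedFieldType)
  (iota : {rmorphism K -> Kalg}) := forall x : Kalg, algebraicOver iota x.

Section CyclicModule.
Variables (K : fieldType) (d : {poly K}).

Definition principal_ideal : {pred {poly K}} := fun a => d %| a.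

Fact principal_ideal_zmod_closed : zmod_closed principal_ideal.
Proof.
split=> [|a b]; rewrite !unfold_in /principal_ideal ?dvdp0 // => da db.
by rewrite dvdp_sub.
Qed.

HB.instance Definition _ :=
  GRing.isZmodClosed.Build {poly K} principal_ideal principal_ideal_zmod_closed.

(* A/dA as an A-module. Unlike {poly %/ d}, this is meaningful for every d,     *)
(* in particular d = 1.                                                         *)
Definition cyclic_module := {ideal_quot principal_ideal}.
Local Notation M := cyclic_module.

HB.instance Definition _ := GRing.Zmodule.on M.

Definition cyclic_scale (a : {poly K}) (x : M) : M := \pi_M (a * repr x).

Let cyclic_scaleE a b : cyclic_scale a (\pi_M b) = \pi_M (a * b).
Proof.
have drb : d %| repr (\pi_M b) - b.
  suff: repr (\pi_M b) - b \in principal_ideal by [].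
  by rewrite Quotient.idealrBE reprK.
apply/eqP; rewrite -Quotient.idealrBE -mulrBr.
by rewrite unfold_in /principal_ideal dvdp_mull.
Qed.

Fact cyclic_scaleA a b x :
  cyclic_scale a (cyclic_scale b x) = cyclic_scale (a * b) x.
Proof. by elim/quotW: x => x; rewrite (cyclic_scaleE b) !cyclic_scaleE mulrA. Qed.
Fact cyclic_scale1 : left_id 1 cyclic_scale.
Proof. by elim/quotW => x; rewrite cyclic_scaleE mul1r. Qed.
Fact cyclic_scaleDr : right_distributive cyclic_scale +%R.
Proof.
move=> a; elim/quotW => x; elim/quotW => y.
by rewrite -raddfD !cyclic_scaleE mulrDr raddfD.
Qed.
Fact cyclic_scaleDl x : {morph cyclic_scale^~ x : a b / a + b}.
Proof.
by move=> a b; elim/quotW: x => x; rewrite !cyclic_scaleE mulrDl raddfD.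
Qed.

HB.instance Definition _ := GRing.Zmodule_isLmodule.Build {poly K} M
  cyclic_scaleA cyclic_scale1 cyclic_scaleDr cyclic_scaleDl.

End CyclicModule.

Definition lmod_isomorphic (R : nzRingType) (M N : lmodType R) : Prop :=
  exists f : {linear M -> N}, bijective f.

Section FunctionField.
Variable k : fieldType.
Local Notation A := {poly k}.
Local Notation F := {fraction {poly k}}.

Definition gammaF : {rmorphism A -> F} := @tofrac A.

Definition frac_num (x : F) : A :=
  let r := repr x in \n_r %/ gcdp \n_r \d_r.
Definition frac_den (x : F) : A :=
  let r := repr x in \d_r %/ gcdp \n_r \d_r.

(* For p irreducible and a != 0, the exponent of p in a; i < size a is no       *)
(* restriction, since p ^+ i %| a forces i <= deg a.                            *)
Definition poly_ord (p a : A) : nat := \max_(i < size a | p ^+ i %| a) i.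

(* Only meaningful for x != 0. *)
Definition ord (p : A) (x : F) : int :=
  (poly_ord p (frac_num x))%:Z - (poly_ord p (frac_den x))%:Z.

Section Residue.
Variables (p : A) (hp : monic_irreducible_poly p).
Local Notation Fp := {poly %/ p with hp}.

Definition residue (a : A) : Fp := in_qpoly p a.

Fact residue_zmod_morphism : zmod_morphism residue.
Proof. exact: (raddfB (in_qpoly p)). Qed.
Fact residue_monoid_morphism : monoid_morphism residue.
Proof. exact: (in_qpoly_monoid_morphism p). Qed.

HB.instance Definition _ :=
  GRing.isZmodMorphism.Build A Fp residue residue_zmod_morphism.
HB.instance Definition _ :=
  GRing.isMonoidMorphism.Build A Fp residue residue_monoid_morphism.

(* Reduction modulo p of an x in F with ord_p(x) >= 0: the denominator of x in  *)
(* lowest terms is then prime to p. Junk value (0) otherwise.                   *)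
Definition frac_residue (x : F) : Fp :=
  residue (frac_num x) / residue (frac_den x).

End Residue.
End FunctionField.

Section Reduction.
Variables (k : finFieldType).
Variable psi : {lrmorphism {poly k} -> tpoly (gammaF k)}.

(* ord_p(g_1) >= 0 and ord_p(g_2) = 0, with the convention ord_p(0) = +oo *)
Definition good_reduction (p : {poly k}) : bool :=
  let g1 := (psi 'X)`_1 in let g2 := (psi 'X)`_2 in
  [&& (g1 != 0) ==> (0 <= ord p g1), g2 != 0 & ord p g2 == 0].

Variables (p : {poly k}) (hp : monic_irreducible_poly p).

Definition reduction_T : tpoly (residue hp) :=
  map_poly (frac_residue hp) (psi 'X).

(* The F_q-algebra morphism A -> F_p{tau} sending T to reduction_T. *)
Definition reduction (a : {poly k}) : tpoly (residue hp) :=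
  horner_alg reduction_T a.

HB.instance Definition _ :=
  GRing.RMorphism.copy reduction (horner_alg reduction_T).

Fact reduction_is_scalable : scalable reduction.
Proof.
move=> c a; have redC : reduction c%:P = c%:A by apply: horner_algC.
by rewrite -mul_polyC (rmorphM reduction) -mulr_algl -redC.
Qed.

HB.instance Definition _ := GRing.isScalable.Build k {poly k}
  (tpoly (residue hp)) *:%R reduction reduction_is_scalable.

End Reduction.

(* |a| = q ^ deg a *)
Definition poly_abs (k : finFieldType) (a : {poly k}) : nat :=
  if a == 0 then 0%N else (#|k| ^ (size a).-1)%N.

(* Main.v *)
Require Import Defs.
From HB Require Import structures.
From mathcomp Require Import all_boot all_order all_algebra all_field.
From mathcomp Require Import reals exp.
From mathcomp Require boolp.
From mathcomp Require Import zify ring lra.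

Set Implicit Arguments.
Unset Strict Implicit.
Unset Printing Implicit Defensive.

Import Order.TTheory GRing.Theory Num.Theory.
Local Open Scope ring_scope.
Local Open Scope quotient_scope.

(* Write P = deg p and let phi be the reduction of psi. Since the d1-torsion of
   the residue field has q^(2 deg d1) elements, the Frobenius tau^P satisfies
   tau^P - 1 = v phi_{d1} for an endomorphism v of phi that is not in phi(A), and
   deg v = P - 2 deg d1 <= deg d2 - deg d1. So it suffices to prove
   P <= B (m + 1) q^m whenever phi has an endomorphism u of degree <= m outside
   phi(A), with B depending only on q and psi.

   Take u of minimal degree. Comparing leading coefficients shows that
   u^2 = phi_a + phi_b u with a and b of degree O(m). Commutation with phi_T
   determines all the coefficients of u from the constant one, u_0, by a
   recurrence; the same recurrence for psi, started at a root x of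
   X^2 - b X - a in the algebraic closure of F, yields a sequence z_n. Both u_n
   and z_n come from one element r_n + s_n X of A[X]/(X^2 - b X - a), of height
   O((m + n) q^n) after clearing denominators. For n = m + 1 and n = m + 2 we have
   u_n = 0, so p divides the norm of r_n + s_n X. If P is large this norm is
   zero, hence z_n = 0, and so sum_n z_n tau^n is an endomorphism of psi. It then
   lies in psi(A), so x is in A, which contradicts u not in phi(A). *)

(** * Twisted polynomials *)

Section Twisted.
Variables (k : finFieldType) (L : fieldType) (gamma : {rmorphism {poly k} -> L}).
Local Notation q := #|k|.
Local Notation Ltau := (tpoly gamma).

Lemma coef_tmul (u v : Ltau) n :
  (u * v : Ltau)`_n = \sum_(i < n.+1) u`_i * v`_(n - i) ^+ (q ^ i).
Proof.
transitivity ((tmul u v)`_n); first by [].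
rewrite /tmul coef_sum.
under eq_bigr => i _ do rewrite coef_sum.
transitivity (\sum_(i < size u) if (i < n.+1)%N then u`_i * v`_(n - i) ^+ (q ^ i) else 0).
  apply: eq_bigr => i _; under eq_bigr => j _ do rewrite coefZ coefXn.
  case: ltnP => [le_in | lt_ni]; last first.
    rewrite big1 // => j _; rewrite ltn_eqF ?mulr0 //.
    by rewrite (leq_trans lt_ni) ?leq_addr.
  have [lt_v|le_v] := ltnP (n - i) (size v).
    rewrite (bigD1 (Ordinal lt_v)) //= subnKC // eqxx mulr1 big1 ?addr0 // => j.
    rewrite -val_eqE /= => nj; case: eqP; rewrite ?mulr0 // => nE.
    by rewrite nE addKn eqxx in nj.
  rewrite [v`__]nth_default // (exprq0 k) mulr0 big1 // => j _.
  case: eqP; rewrite ?mulr0 // => nE.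
  by rewrite nE addKn leqNgt ltn_ord in le_v.
pose G i := if (i < n.+1)%N then u`_i * v`_(n - i) ^+ (q ^ i) else 0.
rewrite -[LHS]/(\sum_(i < size u) G i).
transitivity (\sum_(i < maxn (size u) n.+1) G i).
  rewrite (big_ord_widen _ G (leq_maxl _ n.+1)) big_mkcond /=.
  apply: eq_bigr => i _; case: ltnP => // le_ui.
  by rewrite /G nth_default // mul0r if_same.
rewrite -[RHS]/(\sum_(i < n.+1) (fun i => u`_i * v`_(n - i) ^+ (q ^ i)) i).
by rewrite (big_ord_widen _ _ (leq_maxr (size u) n.+1)) [RHS]big_mkcond.
Qed.

Lemma coef0_tmul (u v : Ltau) : (u * v : Ltau)`_0 = u`_0 * v`_0.
Proof. by rewrite coef_tmul big_ord1 expn0 expr1. Qed.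

Lemma coef_tmul_lead (u v : Ltau) m n : (size u <= m.+1)%N -> (size v <= n.+1)%N ->
  (u * v : Ltau)`_(m + n) = u`_m * v`_n ^+ (q ^ m).
Proof.
move=> su sv; rewrite coef_tmul.
have lt_m : (m < (m + n).+1)%N by rewrite ltnS leq_addr.
rewrite (bigD1 (Ordinal lt_m)) //= addKn big1 ?addr0 // => i.
rewrite -val_eqE /= => ne_im; have [lt_im|lt_mi|/eqP] := ltngtP i m.
- by rewrite [v`__]nth_default ?(exprq0 k) ?mulr0 // (leq_trans sv); lia.
- by rewrite [u`__]nth_default ?mul0r // (leq_trans su); lia.
- by rewrite (negPf ne_im).
Qed.

Lemma size_tmul_leq (u v : Ltau) : (size (u * v)%R <= (size u + size v).-1)%N.
Proof.
apply/leq_sizeP => j le_j; rewrite coef_tmul big1 // => i _.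
have [lt_u|le_u] := ltnP i (size u); last by rewrite nth_default ?mul0r.
rewrite [v`__]nth_default ?(exprq0 k) ?mulr0 //.
have aux a b : (i < a)%N -> ((a + b).-1 <= j)%N -> (b <= j - i)%N by lia.
exact: aux lt_u le_j.
Qed.

Lemma expq_eq0 i (x : L) : (x ^+ (q ^ i) == 0) = (x == 0).
Proof. by rewrite expf_eq0 expn_gt0 (ltnW (finNzRing_gt1 k)). Qed.

Lemma coef_neq0_size (u : Ltau) n : u`_n != 0 -> (n < size u)%N.
Proof. by move=> u0; rewrite ltnNge; apply: contra u0 => le; rewrite nth_default. Qed.

Lemma size_lead (u : Ltau) n : size u = n.+1 -> u`_n != 0.
Proof.
move=> su; have: lead_coef (u : {poly L}) != 0.
  by rewrite lead_coef_eq0 -size_poly_gt0 su.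
by rewrite lead_coefE su.
Qed.

Lemma size_tmul (u v : Ltau) m n : size u = m.+1 -> size v = n.+1 ->
  size (u * v : Ltau) = (m + n).+1.
Proof.
move=> su sv; apply/anti_leq/andP; split.
  by apply: leq_trans (size_tmul_leq u v) _; rewrite su sv addnS addSn.
apply: coef_neq0_size; rewrite coef_tmul_lead ?su ?sv //.
by rewrite mulf_neq0 ?expq_eq0 ?size_lead.
Qed.

Lemma size0_tpoly (u : Ltau) : size u = 0%N -> u = 0.
Proof. by move=> su; apply/eqP; rewrite -(size_poly_eq0 (u : {poly L})) su. Qed.

Lemma tpoly0_size : size (0 : Ltau) = 0%N.
Proof. exact: size_poly0. Qed.

Lemma tmul_eq0 (u v : Ltau) : u * v = 0 -> u = 0 \/ v = 0.
Proof.
case su: (size u) => [|m]; first by rewrite (size0_tpoly su); left.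
case sv: (size v) => [|n]; first by rewrite (size0_tpoly sv); right.
by move=> uv0; have := size_tmul su sv; rewrite uv0 tpoly0_size.
Qed.

Lemma coef_tD (u v : Ltau) n : (u + v)`_n = u`_n + v`_n.
Proof. exact: (coefD (u : {poly L}) v). Qed.
Lemma coef_tB (u v : Ltau) n : (u - v)`_n = u`_n - v`_n.
Proof. exact: (coefB (u : {poly L}) v). Qed.
Lemma size_tB (u v : Ltau) n : (size u <= n)%N -> (size v <= n)%N -> (size (u - v)%R <= n)%N.
Proof.
move=> su sv; apply/leq_sizeP => j le_j; rewrite coef_tB.
by rewrite !nth_default ?subr0 // (leq_trans _ le_j).
Qed.

Lemma size_tB_lead (u v : Ltau) n : (size u <= n.+1)%N -> (size v <= n.+1)%N ->
  u`_n = v`_n -> (size (u - v)%R <= n)%N.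
Proof.
move=> su sv uv; apply/leq_sizeP => j; rewrite leq_eqVlt => /orP[/eqP<-|lt_j].
  by rewrite coef_tB uv subrr.
by move: j lt_j; apply/leq_sizeP/size_tB.
Qed.

(** The element c tau^j. The scaling is that of [{poly L}], since L{tau} is an algebra over F_q
    only. *)
Definition tmonom (c : L) (j : nat) : Ltau := c *: ('X^j : {poly L}).

Lemma coef_tmonom c j n : (tmonom c j)`_n = if n == j then c else 0.
Proof. by rewrite coefZ coefXn; case: eqP => _; rewrite ?mulr1 ?mulr0. Qed.

Lemma size_tmonom c j : c != 0 -> size (tmonom c j) = j.+1.
Proof. by move=> c0; rewrite size_scale // size_polyXn. Qed.

(** Euclidean division with the divisor on the right: c tau^j v has leading coefficient c v_n^(q^j),
    so cancelling that of w never requires a q-th root and L need not be perfect. *)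
Lemma tdivide (w v : Ltau) : v != 0 ->
  exists u r : Ltau, w = u * v + r /\ (size r < size v)%N.
Proof.
move=> v0; have [n sv] : exists n, size v = n.+1.
  case sv: (size v) => [|n]; last by exists n.
  by rewrite (size0_tpoly sv) eqxx in v0.
have lv := size_lead sv.
have [N] := ubnP (size w); elim: N w => // N IH w sw.
have [lt_w|le_v] := ltnP (size w) (size v).
  by exists 0, w; rewrite mul0r add0r.
have [j Ej] : exists j, size w = (j + n).+1.
  by exists (size w - n.+1)%N; rewrite -addnS subnK // -sv.
pose c := w`_(j + n) / v`_n ^+ (q ^ j).
have c0 : c != 0 by rewrite mulf_neq0 ?invr_eq0 ?expq_eq0 // size_lead.
pose m : Ltau := tmonom c j.
have sm : size m = j.+1 by apply: size_tmonom.
have smv : size (m * v) = (j + n).+1 by apply: size_tmul.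
have [|u [r [E sr]]] := IH (w - m * v).
  apply: leq_trans (_ : (j + n < _)%N); last by rewrite Ej in sw.
  rewrite ltnS size_tB_lead ?Ej ?smv // coef_tmul_lead ?sm ?sv //.
  by rewrite coef_tmonom eqxx /c divfK // expq_eq0.
exists (u + m), r; split => //.
by rewrite mulrDl addrAC -E subrK.
Qed.

(** The action of r is that of the polynomial with terms r_i X^(q^i), of degree at most q^n; the
    exponents q^i are distinct, so r can be read off from its coefficients. *)
Lemma teval_roots (r : Ltau) (n : nat) (s : seq L) : (size r <= n.+1)%N ->
  uniq s -> (forall x, x \in s -> teval r x = 0) -> (q ^ n < size s)%N -> r = 0.
Proof.
move=> sr us rs lt_s; pose P : {poly L} := \sum_(i < size r) r`_i *: 'X^(q ^ i).
have q1 : (1 < q)%N := finNzRing_gt1 k.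
have sP : (size P <= (q ^ n).+1)%N.
  apply: (leq_trans (size_sum _ _ _)); apply/bigmax_leqP => i _.
  apply: (leq_trans (size_scale_leq _ _)); rewrite size_polyXn ltnS leq_exp2l //.
  by rewrite -ltnS (leq_trans (ltn_ord i) sr).
have P0 : P = 0.
  apply/eqP; case: eqVneq => // nzP.
  suff /(leq_trans)/(_ sP) : (size s < size P)%N by rewrite ltnS leqNgt lt_s.
  apply: max_poly_roots => //; apply/allP => x /rs rx.
  rewrite /root -[X in _ == X]rx /teval horner_sum.
  by apply/eqP/eq_bigr => i _; rewrite hornerZ hornerXn.
apply: (@polyP L (r : {poly L}) 0).1 => i; rewrite coef0.
have [le_r|lt_r] := leqP (size r) i; first by rewrite nth_default.
have := congr1 (fun Q : {poly L} => Q`_(q ^ i)) P0; rewrite coef0 coef_sum.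
rewrite (bigD1 (Ordinal lt_r)) //= coefZ coefXn eqxx mulr1 big1 ?addr0 // => j.
rewrite -val_eqE coefZ coefXn eqn_exp2l // eq_sym => /= /negPf->.
by rewrite mulr0.
Qed.

Lemma tau_comm j (v : Ltau) : (forall n, v`_n ^+ (q ^ j) = v`_n) ->
  tmonom 1 j * v = v * tmonom 1 j.
Proof.
move=> vq; apply: (@polyP L (_ : {poly L}) _).1 => n; rewrite !coef_tmul.
under eq_bigr => i _ do rewrite coef_tmonom.
under [RHS]eq_bigr => i _ do rewrite coef_tmonom.
have [le_jn|lt_nj] := leqP j n; last first.
  rewrite !big1 // => i _; last by rewrite ltn_eqF ?mul0r // (leq_ltn_trans _ lt_nj) -1?ltnS.
  by rewrite ltn_eqF ?(exprq0 k) ?mulr0 // (leq_ltn_trans _ lt_nj) ?leq_subr.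
have lt_j : (j < n.+1)%N by [].
have lt_nj : (n - j < n.+1)%N by rewrite ltnS leq_subr.
rewrite (bigD1 (Ordinal lt_j)) //= eqxx mul1r vq big1 ?addr0; last first.
  by move=> i; rewrite -val_eqE => /= /negPf->; rewrite mul0r.
rewrite (bigD1 (Ordinal lt_nj)) //= subKn // eqxx expr1n mulr1 big1 ?addr0 //.
move=> i; rewrite -val_eqE /= => ne; rewrite (_ : (_ == _) = false) ?(exprq0 k) ?mulr0 //.
by have := ltn_ord i; lia.
Qed.

Lemma teval_tau j x : teval (tmonom 1 j) x = x ^+ (q ^ j).
Proof.
rewrite /teval size_tmonom ?oner_eq0 // big_ord_recr big1 /= => [|i _].
  by rewrite coef_tmonom eqxx mul1r add0r.
by rewrite coef_tmonom ltn_eqF ?mul0r.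
Qed.

(** X^q - X is the product of the X - c with c in k, and this factorisation persists over L. *)
Lemma fixed_expq (x : L) : x ^+ q = x -> exists c : k, x = gamma c%:P.
Proof.
move=> xq; pose f := gamma \o polyC : {rmorphism k -> L}.
have := congr1 (map_poly f) (finField_genPoly k).
rewrite rmorphB /= map_polyXn map_polyX rmorph_prod /=.
move=> /(congr1 (fun P : {poly L} => P.[x])); rewrite !hornerE xq subrr.
rewrite horner_prod => /esym/eqP/prodf_eq0[c _].
by rewrite /= map_polyXsubC !hornerE subr_eq0 => /eqP ->; exists c.
Qed.

(* Comparing leading coefficients in [v y = y v] and [v' y = y v']. *)
Lemma lead_twist (v v' y : Ltau) n m mu : size v = n.+1 -> (size v' <= n.+1)%N ->
  size y = m.+1 -> v'`_n = mu * v`_n -> v * y = y * v -> v' * y = y * v' ->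
  mu ^+ (q ^ m) = mu.
Proof.
move=> sv sv' sy E c1 c2.
have E1 : v`_n * y`_m ^+ (q ^ n) = y`_m * v`_n ^+ (q ^ m).
  by rewrite -!coef_tmul_lead ?sv ?sy // c1 addnC.
have E2 : v'`_n * y`_m ^+ (q ^ n) = y`_m * v'`_n ^+ (q ^ m).
  by rewrite -!coef_tmul_lead ?sv ?sy // c2 addnC.
have ly := size_lead sy; have lv := size_lead sv.
apply: (mulIf (_ : y`_m * v`_n ^+ (q ^ m) != 0)).
  by rewrite mulf_neq0 // expq_eq0.
by rewrite mulrCA -exprMn -E -E2 E -mulrA E1.
Qed.

End Twisted.

(** * Endomorphisms of rank 2 Drinfeld modules *)

Section Rank2.
Variables (k : finFieldType) (L : fieldType) (gamma : {rmorphism {poly k} -> L}).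
Local Notation q := #|k|.
Local Notation Ltau := (tpoly gamma).
Variable phi : {lrmorphism {poly k} -> Ltau}.

Lemma gammaC_eq0 c : (gamma c%:P == 0) = (c == 0).
Proof. exact: (fmorph_eq0 (gamma \o polyC)). Qed.

Lemma coef_phiZ c a n : (phi (c *: a))`_n = gamma c%:P * (phi a)`_n.
Proof. by rewrite linearZ; apply: coefZ. Qed.

Lemma phiC c : phi c%:P = c *: 1.
Proof. by rewrite -alg_polyC linearZ rmorph1. Qed.

Lemma phi_MXaddC a c : phi (a * 'X + c%:P) = phi a * phi 'X + c *: 1.
Proof. by rewrite -phiC rmorphD rmorphM. Qed.

Lemma phi_comm (u : Ltau) : u * phi 'X = phi 'X * u ->
  forall a, u * phi a = phi a * u.
Proof.
move=> uT; elim/poly_ind => [|a c IH]; first by rewrite !raddf0 mulr0 mul0r.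
rewrite phi_MXaddC mulrDr mulrDl !mulrA IH -!mulrA uT; congr (_ + _).
by rewrite -scalerAr -scalerAl mulr1 mul1r.
Qed.

Hypothesis phi0 : (phi 'X)`_0 = gamma 'X.

Lemma coef0_phi a : (phi a)`_0 = gamma a.
Proof.
elim/poly_ind: a => [|a c IH]; first by rewrite !raddf0 coef0.
rewrite phi_MXaddC coef_tD coef0_tmul IH phi0 rmorphD rmorphM; congr (_ + _).
by rewrite [LHS]coefZ coefC eqxx mulr1.
Qed.

Hypothesis sphi : size (phi 'X) = 3%N.

Lemma size_phi (a : {poly k}) j : size a = j.+1 -> size (phi a) = j.*2.+1.
Proof.
elim/poly_ind: a j => [|a c IH] j; first by rewrite size_poly0.
rewrite size_MXaddC; case: eqP => [->|/eqP a0] /=.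
  case: eqP => // /eqP c0 [<-].
  rewrite mul0r add0r phiC size_poly0.
  transitivity (size (gamma c%:P *: (1 : {poly L}))); first by [].
  by rewrite size_scale ?gammaC_eq0 // size_poly1.
case sa: (size a) => [|i]; first by rewrite -size_poly_eq0 sa in a0.
case=> <-; have si := IH i sa.
have sT : size (phi a * phi 'X) = i.+1.*2.+1 by rewrite (size_tmul si sphi) addn2.
rewrite phi_MXaddC (@size_polyDl L) ?sT //.
by rewrite (leq_ltn_trans (size_scale_leq _ _)) // size_poly1.
Qed.

Definition is_scalar (u : Ltau) := exists a, u = phi a.

(** Dividing r by s with remainder r1 gives phi_s (u - phi_{r/s}) = phi_{r1}. As deg r1 < deg s,
    comparing degrees forces u = phi_{r/s}. *)
Lemma scalar_saturated s r (u : Ltau) :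
  s != 0 -> phi s * u = phi r -> is_scalar u.
Proof.
move=> s0 E; exists (r %/ s); apply/eqP; rewrite -subr_eq0; apply/eqP.
have E' : phi s * (u - phi (r %/ s)) = phi (r %% s).
  by rewrite mulrBr E -rmorphM -rmorphB {1}(divp_eq r s) addrC [s * _]mulrC addKr.
have := ltn_modpN0 r s0; set r1 := r %% s in E' *.
set v := u - _ in E' *; case sv: (size v) => [|n]; first by rewrite (size0_tpoly sv).
case ss: (size s) => [|i]; first by move/eqP: ss; rewrite size_poly_eq0 (negPf s0).
have := size_tmul (size_phi ss) sv; rewrite E'.
case sr: (size r1) => [|j].
  by move/eqP: sr; rewrite size_poly_eq0 => /eqP->; rewrite raddf0 tpoly0_size.
by rewrite (size_phi sr) => -[E1] lt_ji; exfalso; lia.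
Qed.

Lemma phiXn_comm (u : Ltau) j : u * phi 'X = phi 'X * u ->
  phi 'X^j * u = u * phi 'X^j.
Proof. by move=> uT; rewrite phi_comm. Qed.

Lemma phiX_comm a : phi a * phi 'X = phi 'X * phi a.
Proof. by rewrite -!rmorphM mulrC. Qed.

(** A factor fixed by the q-power map is a constant c of F_q, so b = c T^j works. *)
Lemma scalar_monomial (w v : Ltau) n j mu : mu ^+ q = mu ->
  w`_n = mu * (phi 'X^j * v : Ltau)`_n ->
  exists2 b : {poly k}, (size b <= j.+1)%N & (phi b * v : Ltau)`_n = w`_n.
Proof.
move=> /(fixed_expq gamma)[c ->] ->; exists (c *: 'X^j).
  by rewrite (leq_trans (size_scale_leq _ _)) // size_polyXn.
by rewrite linearZ -scalerAl; apply: (coefZ (gamma c%:P) (phi 'X^j * v : {poly L}) n).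
Qed.

Lemma expq_double (x : L) n : x ^+ (q ^ 2) = x -> x ^+ (q ^ n.*2) = x.
Proof.
move=> x2; elim: n => [|n IH]; first by rewrite expr1.
by rewrite doubleS -addn2 expnD exprM IH.
Qed.

Lemma expq_odd (x : L) n : x ^+ (q ^ 2) = x -> odd n -> x ^+ (q ^ n) = x ^+ q.
Proof.
move=> x2 on; rewrite -[n]odd_double_half on add1n expnSr exprM.
by rewrite expq_double.
Qed.

Lemma size_phiXn j : size (phi 'X^j) = j.*2.+1.
Proof. by apply: size_phi; rewrite size_polyXn. Qed.

(** * The commutant of an endomorphism of minimal degree outside phi(A) *)

Section Minimal.
Variables (u : Ltau) (m : nat).
Hypotheses (uT : u * phi 'X = phi 'X * u) (su : size u = m.+1).
Hypothesis umin : forall w : Ltau, w * phi 'X = phi 'X * w ->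
  (size w <= m)%N -> is_scalar w.
Hypothesis uN : ~ is_scalar u.

(** If [lam] were in F_q, subtracting [lam] phi_{T^i} from u would leave a commuting element of
    smaller degree, which is in phi(A) by minimality; then u would be too. *)
Lemma lead_not_fixed i lam : m = i.*2 -> u`_m = lam * (phi 'X^i)`_m ->
  lam ^+ q != lam.
Proof.
move=> mE ulam; apply/eqP => lamq; apply: uN.
have [|b sb Eb] := @scalar_monomial u 1 m i lam lamq; first by rewrite mulr1.
rewrite mulr1 in Eb.
have sb' : (size (phi b) <= m.+1)%N.
  case sb': (size b) => [|l].
    by move/eqP: sb'; rewrite size_poly_eq0 => /eqP->; rewrite raddf0 tpoly0_size.
  by rewrite (size_phi sb') mE; lia.
have [||a Ea] := umin (w := u - phi b).
- by rewrite mulrBl mulrBr uT phiX_comm.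
- by apply: size_tB_lead; rewrite ?su.
by exists (a + b); rewrite raddfD /= -Ea subrK.
Qed.

(* The ratio of the leading coefficients of two elements of the same degree that
   commute with phi_T lies in F_{q^2}, and in F_q if they also commute with an
   element of odd degree. If m and n are even, then F_{q^2} is spanned over F_q by
   1 and the ratio [lam], which is not in F_q by minimality of [u]. *)
Lemma approx_lead (w : Ltau) n : w * phi 'X = phi 'X * w -> w * u = u * w ->
  size w = n.+1 -> (m <= n)%N ->
  exists a b : {poly k}, [/\ (size a <= n.+1)%N, (size b <= n.+1)%N,
    (size (phi a + phi b * u)%R <= n.+1)%N & (phi a + phi b * u)`_n = w`_n].
Proof.
move=> wT wu sw le_mn.
have tT j : phi 'X^j * phi 'X = phi 'X * phi 'X^j := phiX_comm _.
have tu j : phi 'X^j * u = u * phi 'X^j by apply: phiXn_comm.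
have fix2 (v v' : Ltau) l mu : size v = l.+1 -> (size v' <= l.+1)%N ->
    v'`_l = mu * v`_l -> v * phi 'X = phi 'X * v -> v' * phi 'X = phi 'X * v' ->
    mu ^+ (q ^ 2) = mu by move=> *; apply: lead_twist; eauto.
have mono (v : Ltau) j mu : mu ^+ q = mu -> size v = (n - j.*2).+1 -> (j.*2 <= n)%N ->
    w`_n = mu * (phi 'X^j * v : Ltau)`_n ->
    exists b : {poly k}, [/\ (size b <= n.+1)%N, (size (phi b * v)%R <= n.+1)%N
      & (phi b * v)`_n = w`_n].
  move=> muq sv le_jn Ew; have [b sb Eb] := scalar_monomial muq Ew.
  exists b; split=> //; first by rewrite (leq_trans sb) // ltnS; lia.
  case sb': (size b) => [|i].
    by move/eqP: sb'; rewrite size_poly_eq0 => /eqP->; rewrite raddf0 mul0r tpoly0_size.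
  by rewrite (size_tmul (size_phi sb') sv) sb' in sb *; lia.
case on: (odd n); case om: (odd m).
(* Both degrees odd: w is compared with phi_{T^j} u, and commutation with u puts the ratio in
   F_q. *)
- have [j Ej] : exists j, (n = j.*2 + m)%N.
    by exists ((n - m)./2); rewrite halfK oddB // on om subn0 subnK.
  pose v := phi 'X^j * u.
  have sv : size v = n.+1 by rewrite (size_tmul (size_phiXn j) su) Ej.
  pose mu := w`_n / v`_n; have Ew : w`_n = mu * v`_n by rewrite divfK ?size_lead.
  have vT : v * phi 'X = phi 'X * v by rewrite -mulrA uT mulrA tT -mulrA.
  have mu2 : mu ^+ (q ^ 2) = mu by apply: fix2 Ew vT wT; rewrite ?sw.
  have vu : v * u = u * v by rewrite mulrA -tu.
  have mum : mu ^+ (q ^ m) = mu by apply: lead_twist sv _ su Ew vu wu; rewrite sw.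
  have [||||b [sb sbu Eb]] := mono u j mu.
  - by rewrite -(expq_odd mu2 om).
  - by rewrite su Ej addKn.
  - by rewrite Ej leq_addr.
  - by [].
  by exists 0, b; rewrite raddf0 !add0r size_poly0.
(* This case cannot occur: u and phi_{T^i} both commute with w, of odd degree, which would put [lam]
   in F_q. *)
- have [i Ei] : exists i, m = i.*2 by exists m./2; rewrite halfK om subn0.
  pose lam := u`_m / (phi 'X^i)`_m.
  have st : size (phi 'X^i) = m.+1 by rewrite size_phiXn Ei.
  have Eu : u`_m = lam * (phi 'X^i)`_m by rewrite divfK ?size_lead.
  have lam2 : lam ^+ (q ^ 2) = lam by apply: fix2 st _ Eu (tT i) uT; rewrite su.
  have tw : phi 'X^i * w = w * phi 'X^i by apply: phiXn_comm.
  have lamn : lam ^+ (q ^ n) = lam by apply: lead_twist st _ sw Eu tw _; rewrite ?su.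
  by have /eqP[] := lead_not_fixed Ei Eu; rewrite -(expq_odd lam2 on).
(* n even and m odd: w is compared with phi_{T^j} alone. *)
- have [j Ej] : exists j, n = j.*2 by exists n./2; rewrite halfK on subn0.
  have st : size (phi 'X^j) = n.+1 by rewrite size_phiXn Ej.
  pose mu := w`_n / (phi 'X^j)`_n.
  have Ew : w`_n = mu * (phi 'X^j)`_n by rewrite divfK ?size_lead.
  have mu2 : mu ^+ (q ^ 2) = mu by apply: fix2 st _ Ew (tT j) wT; rewrite sw.
  have mum : mu ^+ (q ^ m) = mu.
    by apply: lead_twist st _ su Ew (tu j) wu; rewrite sw.
  have [||||b [sb sbu Eb]] := mono 1 j mu.
  - by rewrite -(expq_odd mu2 om).
  - by rewrite Ej subnn; apply: size_poly1.
  - by rewrite Ej.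
  - by rewrite mulr1.
  by exists b, 0; rewrite raddf0 mul0r !addr0 size_poly0; rewrite mulr1 in sbu Eb.
- have [j Ej] : exists j, n = j.*2 by exists n./2; rewrite halfK on subn0.
  have [i Ei] : exists i, m = i.*2 by exists m./2; rewrite halfK om subn0.
  have stj : size (phi 'X^j) = n.+1 by rewrite size_phiXn Ej.
  pose mu := w`_n / (phi 'X^j)`_n.
  have Ew : w`_n = mu * (phi 'X^j)`_n by rewrite divfK ?size_lead.
  have mu2 : mu ^+ (q ^ 2) = mu by apply: fix2 stj _ Ew (tT j) wT; rewrite sw.
  pose lam := u`_m / (phi 'X^i)`_m.
  have st : size (phi 'X^i) = m.+1 by rewrite size_phiXn Ei.
  have Eu : u`_m = lam * (phi 'X^i)`_m by rewrite divfK ?size_lead.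
  have lam2 : lam ^+ (q ^ 2) = lam by apply: fix2 st _ Eu (tT i) uT; rewrite su.
  have lamN : lam ^+ q - lam != 0 by rewrite subr_eq0 (lead_not_fixed Ei Eu).
  have le_ij : (i <= j)%N by lia.
  have sqr (x : L) : x ^+ (q ^ 2) = x -> (x ^+ q) ^+ q = x.
    by rewrite -exprM -[(q * q)%N]/(q ^ 2)%N.
  have qB (x y : L) : (x - y) ^+ q = x ^+ q - y ^+ q.
    apply: (addIr (y ^+ q)); rewrite subrK -[q]expn1 -(exprqD gamma) subrK //.
  (* The solution of mu = al + be lam with al and be in F_q: the q-power map negates both mu^q - mu
     and lam^q - lam, so it fixes their quotient. *)
  pose be := (mu ^+ q - mu) / (lam ^+ q - lam); pose al := mu - be * lam.
  have beq : be ^+ q = be.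
    by rewrite expr_div_n !qB !sqr // -opprB -[X in _ / X]opprB invrN mulrNN.
  have alq : al ^+ q = al.
    rewrite {1}/al qB (exprMn _ be lam) beq; apply/eqP; rewrite -subr_eq0 /al.
    rewrite (_ : _ - _ = (mu ^+ q - mu) - be * (lam ^+ q - lam)); last by ring.
    by rewrite /be divfK // subrr.
  have [ca Eca] := fixed_expq gamma alq; have [cb Ecb] := fixed_expq gamma beq.
  have sa : (size (ca *: 'X^j : {poly k}) <= j.+1)%N.
    by rewrite (leq_trans (size_scale_leq _ _)) // size_polyXn.
  have sb : (size (cb *: 'X^(j - i) : {poly k}) <= (j - i).+1)%N.
    by rewrite (leq_trans (size_scale_leq _ _)) // size_polyXn.
  have spa : (size (phi (ca *: 'X^j)) <= n.+1)%N.
    rewrite linearZ; apply: leq_trans (_ : size (phi 'X^j) <= _)%N; last by rewrite stj.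
    exact: (size_scale_leq (gamma ca%:P) (phi 'X^j : {poly L})).
  have spb : (size (phi (cb *: 'X^(j - i)) * u)%R <= n.+1)%N.
    rewrite linearZ -scalerAl.
    apply: leq_trans (size_scale_leq (gamma cb%:P) (phi 'X^(j-i) * u : {poly L})) _.
    by rewrite (size_tmul (size_phiXn _) su) Ei Ej; lia.
  exists (ca *: 'X^j), (cb *: 'X^(j - i)); split.
  + by rewrite (leq_trans sa) // ltnS Ej; lia.
  + by rewrite (leq_trans sb) // ltnS Ej; lia.
  + by apply: leq_trans (size_polyD _ _) _; rewrite geq_max spa.
  rewrite coef_tD coef_phiZ -Eca linearZ -scalerAl.
  rewrite [X in _ + X = _](coefZ (gamma cb%:P) (phi 'X^(j-i) * u : {poly L})) -Ecb.
  (* As [lam] is fixed by the q^2-power map, the leading coefficient of phi_{T^(j-i)} u is [lam]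
     times that of phi_{T^j}. *)
  have En : n = ((j - i).*2 + m)%N by lia.
  have Etj : (phi 'X^j)`_n = (phi 'X^(j - i))`_(j - i).*2 * ((phi 'X^i)`_m) ^+ (q ^ (j - i).*2).
    rewrite -[in LHS](subnK le_ij) exprD rmorphM /= [in LHS]En.
    by rewrite coef_tmul_lead ?size_phiXn ?Ei.
  rewrite {2}En coef_tmul_lead ?size_phiXn ?su // Eu exprMn expq_double //.
  by rewrite [_ * (lam * _)]mulrCA -Etj mulrA -mulrDl /al Ew subrK.
Qed.

(** Induction on the size of w: [approx_lead] removes the leading coefficient as long as deg w >= m,
    and below degree m minimality puts w in phi(A). *)
Lemma commutant_decomp N (w : Ltau) : w * phi 'X = phi 'X * w -> w * u = u * w ->
  (size w <= N)%N ->
  exists a b : {poly k}, [/\ w = phi a + phi b * u, (size a <= N)%N & (size b <= N)%N].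
Proof.
elim: N w => [|N IH] w wT wu.
  rewrite leqn0 => /eqP/size0_tpoly->; exists 0, 0.
  by rewrite !raddf0 mul0r addr0 size_poly0.
rewrite leq_eqVlt => /orP[/eqP sw|sw]; last first.
  have [a [b [E sa sb]]] := IH w wT wu sw.
  by exists a, b; split=> //; rewrite ltnW.
have [le_mN|lt_Nm] := leqP m N; last first.
  have [|a Ea] := umin wT; first by rewrite sw.
  exists a, 0; rewrite raddf0 mul0r addr0 size_poly0; split=> //.
  case sa: (size a) => [|j] //.
  by move: sw; rewrite Ea (size_phi sa) => -[<-]; lia.
have [a [b [sa sb sab Eab]]] := approx_lead wT wu sw le_mN.
have phiu c : phi c * u = u * phi c by rewrite phi_comm.
have [|||a' [b' [E sa' sb']]] := IH (w - (phi a + phi b * u)).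
- rewrite mulrBl mulrBr wT mulrDl mulrDr -!mulrA uT !mulrA phiX_comm.
  by rewrite phiX_comm.
- rewrite mulrBl mulrBr wu; congr (_ - _).
  by rewrite mulrDl mulrDr (phiu a) mulrA -(phiu b).
- by apply: size_tB_lead; rewrite ?sw.
exists (a' + a), (b' + b); split.
- by rewrite !raddfD mulrDl addrACA -E subrK.
- by rewrite (leq_trans (size_polyD _ _)) // geq_max sa andbT leqW.
- by rewrite (leq_trans (size_polyD _ _)) // geq_max sb andbT leqW.
Qed.

End Minimal.
End Rank2.

(** * The quadratic equation of a minimal endomorphism *)

Section Quad.
Variables (k : finFieldType) (L : fieldType) (gamma : {rmorphism {poly k} -> L}).
Local Notation q := #|k|.
Local Notation Ltau := (tpoly gamma).
Variable phi : {lrmorphism {poly k} -> Ltau}.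
Hypothesis sphi : size (phi 'X) = 3%N.

(** The form in r and s is the norm of r + s X in A[X]/(X^2 - b X - a). If it vanishes, s^2 (X^2 - b
    X - a) is a product of two factors linear in X. Evaluation at u is multiplicative because u
    commutes with phi(A), so one factor vanishes at u, and for s != 0 saturation puts u in
    phi(A). *)
Lemma norm_form_eq0 (u : Ltau) (a b r s : {poly k}) :
  u * phi 'X = phi 'X * u -> ~ is_scalar phi u -> u * u = phi a + phi b * u ->
  r ^+ 2 + r * s * b - s ^+ 2 * a = 0 -> s = 0.
Proof.
move=> uT uN uu N0; apply/eqP; case: eqVneq => // s0; case: uN.
have cfu : commr_rmorph phi u by move=> x; apply: phi_comm.
pose ev : {rmorphism {poly {poly k}} -> Ltau} := horner_morph cfu.
have evC x : ev x%:P = phi x := horner_morphC cfu x.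
have evX : ev 'X = u := horner_morphX cfu.
pose P : {poly {poly k}} := 'X ^+ 2 - b%:P * 'X - a%:P.
have evP : ev P = 0.
  by rewrite /P !rmorphB !rmorphM /= evX !evC uu addrK subrr.
have E : (s%:P * 'X + r%:P) * (s%:P * 'X - (r + s * b)%:P) = s%:P ^+ 2 * P.
  have NP : r%:P ^+ 2 + r%:P * s%:P * b%:P - s%:P ^+ 2 * a%:P = 0 :> {poly {poly k}}.
    by rewrite -!polyC_exp -!polyCM -polyCD -polyCB N0.
  by rewrite polyCD polyCM -[RHS]subr0 -NP /P; ring.
have /tmul_eq0[F|F] : ev (s%:P * 'X + r%:P) * ev (s%:P * 'X - (r + s * b)%:P) = 0.
  by rewrite -rmorphM E rmorphM evP mulr0.
- apply: (scalar_saturated sphi s0 (r := - r)).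
  by move/eqP: F; rewrite rmorphD rmorphM /= evX !evC addr_eq0 rmorphN => /eqP.
- apply: (scalar_saturated sphi s0 (r := r + s * b)).
  by move/eqP: F; rewrite rmorphB rmorphM /= evX !evC subr_eq0 => /eqP.
Qed.

Lemma quadratic_element (v : Ltau) n : v * phi 'X = phi 'X * v ->
    ~ is_scalar phi v -> (size v <= n.+1)%N ->
  exists m (u : Ltau) (a b : {poly k}),
    [/\ (m <= n)%N, u * phi 'X = phi 'X * u, ~ is_scalar phi u & size u = m.+1] /\
    [/\ u * u = phi a + phi b * u, (size a <= m.*2.+1)%N & (size b <= m.*2.+1)%N].
Proof.
have scal0 : is_scalar phi 0 by exists 0; rewrite raddf0.
elim: n v => [|n IH] v vT vN sv; case sv': (size v) => [|m].
- by case: vN; rewrite (size0_tpoly sv').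
- have m0 : m = 0%N by rewrite sv' in sv; lia.
  exists 0%N, v; move: sv'; rewrite m0 => sv'.
  have vmin (w : Ltau) : w * phi 'X = phi 'X * w -> (size w <= 0)%N -> is_scalar phi w.
    by move=> _; rewrite leqn0 => /eqP/size0_tpoly->.
  have [|||a [b [E sa sb]]] := commutant_decomp sphi vT sv' vmin vN (N := 1) (w := v * v).
  + by rewrite -mulrA vT !mulrA vT.
  + by rewrite mulrA.
  + by rewrite (size_tmul sv' sv').
  by exists a, b.
- by case: vN; rewrite (size0_tpoly sv').
have le_mn : (m <= n.+1)%N by rewrite -ltnS -sv'.
(* Either a commuting element of smaller degree lies outside phi(A) and the induction hypothesis
   applies, or v itself is minimal and v^2 decomposes over 1 and v. *)
have [[w [wT wN sw]]|none] := boolp.EM (exists w : Ltau, [/\ w * phi 'X = phi 'X * w,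
  ~ is_scalar phi w & (size w <= m)%N]).
  have [|i [u [a [b [[le_i uT uN su] H]]]]] := IH w wT wN; first exact: leq_trans sw _.
  by exists i, u, a, b; split=> //; split=> //; apply: leqW.
have vmin (w : Ltau) : w * phi 'X = phi 'X * w -> (size w <= m)%N -> is_scalar phi w.
  by move=> wT sw; have [//|wN] := boolp.EM (is_scalar phi w); case: none; exists w.
have [|||a [b [E sa sb]]] := commutant_decomp sphi vT sv' vmin vN (N := m.*2.+1) (w := v * v).
- by rewrite -mulrA vT !mulrA vT.
- by rewrite mulrA.
- by rewrite (size_tmul sv' sv') addnn.
by exists m, v, a, b.
Qed.

End Quad.

(** * The cofactor of Frobenius *)

Section Cofactor.
Variables (k : finFieldType) (L : fieldType) (gamma : {rmorphism {poly k} -> L}).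
Local Notation q := #|k|.
Local Notation Ltau := (tpoly gamma).
Variable phi : {lrmorphism {poly k} -> Ltau}.
Hypothesis phi0 : (phi 'X)`_0 = gamma 'X.
Hypothesis sphi : size (phi 'X) = 3%N.

(** Divide tau^P - 1 by phi_d on the right. Both vanish on s, hence so does the remainder, which has
    too small a degree to be nonzero. The quotient commutes with phi_T because tau^P - 1 and phi_d
    do and phi_d can be cancelled. *)
Lemma frobenius_cofactor P (d : {poly k}) j (s : seq L) :
    (0 < P)%N -> (forall x : L, x ^+ (q ^ P) = x) ->
    (forall b : {poly k}, gamma b = 0 -> b != 0 -> (P < size b)%N) ->
    size d = j.+1 -> uniq s -> (q ^ j.*2 <= size s)%N ->
    (forall x, x \in s -> teval (phi d) x = 0) ->
  exists (u : Ltau) n, [/\ u * phi 'X = phi 'X * u, ~ is_scalar phi u,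
    size u = n.+1 & (n + j.*2)%N = P].
Proof.
move=> P0 LP gP sd us ss sroot.
have q1 : (1 < q)%N := finNzRing_gt1 k.
have spd := size_phi sphi sd.
have pd0 : phi d != 0 by apply/eqP => pd0; move: spd; rewrite pd0 tpoly0_size.
have [u [r [E sr]]] := tdivide (tmonom gamma 1 P - 1) pd0.
have tE (x : L) : teval (tmonom gamma 1 P - 1) x = 0.
  have := tevalDl x (tmonom gamma 1 P - 1) 1.
  by rewrite subrK teval_tau LP teval1 -{1}[x]add0r => /addIr.
have r0 : r = 0.
  (* For deg d = 0 the remainder has size 0 at once; otherwise its degree is at most 2 deg d - 1,
     and q^(2 deg d) roots are too many. *)
  case: j sd ss spd sr => [|j] sd ss spd sr.
    by move: sr; rewrite spd ltnS leqn0 => /eqP/size0_tpoly.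
  apply: (@teval_roots _ _ _ r j.*2.+1 s) => //.
  - by rewrite spd doubleS in sr.
  - move=> x /sroot xr; have := tevalDl x (u * phi d) r.
    rewrite -E tE tevalM xr => /esym; rewrite -[X in teval u X](subrr x).
    have -> : teval u (x - x) = 0.
      by rewrite subrr; apply: (addIr (teval u 0)); rewrite -tevalDr addr0 add0r.
    by rewrite add0r.
  - by rewrite (leq_trans _ ss) // ltn_exp2l // doubleS.
rewrite {sr} r0 addr0 in E.
have sE : size (tmonom gamma 1 P - 1) = P.+1.
  have s1 : size (- 1 : Ltau) = 1%N := etrans (size_polyN (1 : {poly L})) (size_poly1 L).
  by rewrite (@size_polyDl L) size_tmonom ?oner_eq0 // s1.
case su: (size u) => [|n].
  by move: sE; rewrite E (size0_tpoly su) mul0r tpoly0_size.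
have nP : (n + j.*2)%N = P.
  by move: sE; rewrite E (size_tmul su spd) => -[].
exists u, n; split=> //.
  apply/eqP; rewrite -subr_eq0; apply/eqP.
  have /tmul_eq0[//|pd0'] : (u * phi 'X - phi 'X * u) * phi d = 0.
    rewrite mulrBl -!mulrA -phiX_comm [X in X - _]mulrA -E.
    by rewrite mulrBl mulrBr mul1r mulr1 tau_comm ?subrr.
  by rewrite pd0' eqxx in pd0.
(* If u = phi_a, then tau^P = phi_b with b = a d + 1. Its constant coefficient is 0, so gamma kills
   b and deg b >= P, whereas 2 deg b = P > 0. *)
case=> a ua.
have EX : tmonom gamma 1 P = phi (a * d + 1).
  by rewrite rmorphD rmorphM rmorph1 /= -ua -E subrK.
set b := a * d + 1 in EX.
have gb : gamma b = 0.
  rewrite -(coef0_phi phi0) -EX coef_tmonom; case: eqP => // P00.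
  by rewrite -P00 in P0.
have sX : size (phi b) = P.+1 by rewrite -EX size_tmonom ?oner_eq0.
case sb: (size b) => [|i].
  by move: sX; move/eqP: sb; rewrite size_poly_eq0 => /eqP->; rewrite raddf0 tpoly0_size.
have := gP b gb; rewrite -size_poly_eq0 sb => /(_ isT).
by move: sX; rewrite (size_phi sphi sb) => -[]; lia.
Qed.

End Cofactor.

(** * Cardinality and d1-torsion of A/d1 x A/d2 *)

Section Torsion.
Variables (k : finFieldType) (L : finFieldType) (gamma : {rmorphism {poly k} -> L}).
Local Notation q := #|k|.
Variable phi : {lrmorphism {poly k} -> tpoly gamma}.
Variables (d1 d2 : {poly k}).
Hypothesis d10 : d1 != 0.
Hypothesis d20 : d2 != 0.
Hypothesis d12 : d1 %| d2.
Hypothesis iso : lmod_isomorphic (Drinfeld_module phi)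
          (cyclic_module d1 * cyclic_module d2)%type.

Lemma cyclic_pi_eq (d a b : {poly k}) :
  (\pi_(cyclic_module d) a == \pi_(cyclic_module d) b) = (d %| a - b).
Proof. by rewrite -Quotient.idealrBE. Qed.

Lemma cyclic_scaleE (d a b : {poly k}) :
  a *: (\pi_(cyclic_module d) b : cyclic_module d) = \pi_(cyclic_module d) (a * b).
Proof.
transitivity (cyclic_scale a (\pi_(cyclic_module d) b : cyclic_module d)); first by [].
apply/eqP; rewrite cyclic_pi_eq -mulrBr dvdp_mull //.
by rewrite -cyclic_pi_eq reprK.
Qed.

(** Remainders modulo d1 and d2 embed L into pairs of polynomials of degrees below deg d1 and deg
    d2. For L = F_p this yields deg p <= deg d1 + deg d2. *)
Lemma card_le_cyclic : (#|L| <= q ^ ((size d1).-1 + (size d2).-1))%N.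
Proof.
have [f [g fK gK]] := iso.
pose h (x : L) : {poly_(size d1).-1 k} * {poly_(size d2).-1 k} :=
  (npolyp _ (repr (f x).1 %% d1), npolyp _ (repr (f x).2 %% d2)).
have hI : injective h.
  move=> x y [/(congr1 val) /= E1 /(congr1 val) /= E2].
  have sm (d c : {poly k}) : d != 0 -> (size (c %% d)%R <= (size d).-1)%N.
    by move=> d0; rewrite -ltnS prednK ?ltn_modp // size_poly_gt0.
  rewrite !npolypK ?sm // in E1 E2.
  apply: (can_inj fK); apply/eqP; rewrite -pair_eqE /pair_eq /=.
  rewrite -[X in X == _]reprK -[X in _ == X]reprK cyclic_pi_eq.
  rewrite -[X in _ && (X == _)]reprK -[X in _ && (_ == X)]reprK cyclic_pi_eq.
  by rewrite !/dvdp !modpD !modpN E1 E2 !subrr eqxx.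
have := leq_card h hI.
by rewrite card_prod !card_npoly -expnD.
Qed.

(** Since d1 divides d2, multiplication by d2/d1 embeds A/d1 into A/d2, so the d1-torsion contains a
    copy of (A/d1)^2. *)
Lemma torsion_points : exists s : seq L, [/\ uniq s,
  (q ^ (size d1).-1.*2 <= size s)%N & forall x, x \in s -> teval (phi d1) x = 0].
Proof.
have [f [g fK gK]] := iso.
pose h (ab : {poly_(size d1).-1 k} * {poly_(size d1).-1 k}) : L :=
  g (\pi_(cyclic_module d1) (val ab.1), \pi_(cyclic_module d2) (val ab.2 * (d2 %/ d1))).
have E2 : d2 = d2 %/ d1 * d1 by rewrite divpK.
have e0 : d2 %/ d1 != 0 by apply: contra_neq d20 => e; rewrite E2 e mul0r.
have small (c : {poly k}) : (size c <= (size d1).-1)%N -> d1 %| c -> c = 0.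
  move=> sc /eqP; rewrite modp_small // (leq_ltn_trans sc) //.
  by rewrite prednK // size_poly_gt0.
have hI : injective h.
  move=> [a b] [a' b'] /(can_inj gK) [/eqP + /eqP].
  rewrite !cyclic_pi_eq -mulrBl {1}E2 [_ * d1]mulrC dvdp_mul2r // => da db.
  congr (_, _); apply/val_inj/eqP; rewrite -subr_eq0; apply/eqP/small => //.
  - by rewrite (leq_trans (size_polyD _ _)) // size_polyN geq_max !size_npoly.
  - by rewrite (leq_trans (size_polyD _ _)) // size_polyN geq_max !size_npoly.
exists [seq h ab | ab <- enum [set: {poly_(size d1).-1 k} * {poly_(size d1).-1 k}]]; split.
- by rewrite map_inj_uniq // enum_uniq.
- by rewrite size_map -cardE cardsT card_prod card_npoly -expnD addnn.
move=> _ /mapP[[a b] _ ->]; rewrite /h /=.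
set y := (_, _); transitivity (d1 *: (g y : Drinfeld_module phi)); first by [].
apply: (can_inj fK); rewrite linearZ gK linear0 /y.
have pi0 (d c : {poly k}) : d %| c -> \pi_(cyclic_module d) c = 0 :> cyclic_module d.
  by move=> dc; rewrite -(raddf0 (\pi_(cyclic_module d))); apply/eqP; rewrite cyclic_pi_eq subr0.
congr (_, _); rewrite /= cyclic_scaleE pi0 //; first exact: dvdp_mulr.
by rewrite mulrCA [d1 * _]mulrC -E2 dvdp_mull.
Qed.

End Torsion.

(** * Lifting endomorphisms *)

Section Recurrence.
Variables (k : finFieldType) (K : fieldType) (gamma : {rmorphism {poly k} -> K}).
Local Notation q := #|k|.
Local Notation Ktau := (tpoly gamma).

(** The equation u f = f u, coefficient by coefficient, for f = t + g1 tau + g2 tau^2 and u with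
    coefficients y. In degree 0 it holds automatically, which leaves y_0 free. *)
Definition tau_rec (t g1 g2 : K) (y : nat -> K) :=
  y 1%N * (t ^+ q - t) = g1 * y 0%N ^+ q - g1 * y 0%N /\
  forall n, y n.+2 * (t ^+ (q ^ n.+2) - t) =
    g1 * y n.+1 ^+ q - g1 ^+ (q ^ n.+1) * y n.+1
    + (g2 * y n ^+ (q ^ 2) - g2 ^+ (q ^ n) * y n).

Section Commutation.
Variables (f : Ktau).
Hypothesis sf : (size f <= 3)%N.

Lemma coef_f_mul (u : Ktau) n :
  (f * u)`_n.+2 = f`_0 * u`_n.+2 + f`_1 * u`_n.+1 ^+ q + f`_2 * u`_n ^+ (q ^ 2).
Proof.
rewrite coef_tmul !big_ord_recl /= big1 ?addr0 => [|i _].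
  have bE : bump 0 (bump 0 0) = 2%N by [].
  by rewrite bE -[bump 0 0]/1%N expn0 expr1 !subSS !subn0 expn1 addrA.
by rewrite [f`__]nth_default ?mul0r // (leq_trans sf).
Qed.

Lemma coef_mul_f (u : Ktau) n :
  (u * f)`_n.+2 = u`_n.+2 * f`_0 ^+ (q ^ n.+2) + u`_n.+1 * f`_1 ^+ (q ^ n.+1)
    + u`_n * f`_2 ^+ (q ^ n).
Proof.
rewrite coef_tmul !big_ord_recr /= big1 ?add0r => [|i _].
  rewrite subnn subSnn (_ : (n.+2 - n)%N = 2%N); first by ring.
  by rewrite -addn2 addKn.
rewrite [f`__]nth_default ?(exprq0 k) ?mulr0 // (leq_trans sf) //.
by have := ltn_ord i; lia.
Qed.

Lemma comm_tau_rec (u : Ktau) :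
  u * f = f * u <-> tau_rec f`_0 f`_1 f`_2 (fun n => u`_n).
Proof.
have e1 : ((u * f)`_1 == (f * u)`_1) =
    (u`_1 * (f`_0 ^+ q - f`_0) == f`_1 * u`_0 ^+ q - f`_1 * u`_0).
  rewrite !coef_tmul !big_ord_recr !big_ord0 /= !add0r !subn0 !subnn !expr1.
  rewrite -subr_eq0 -[RHS]subr_eq0; congr (_ == _); ring.
have e2 n : ((u * f)`_n.+2 == (f * u)`_n.+2) =
    (u`_n.+2 * (f`_0 ^+ (q ^ n.+2) - f`_0) ==
    f`_1 * u`_n.+1 ^+ q - f`_1 ^+ (q ^ n.+1) * u`_n.+1
    + (f`_2 * u`_n ^+ (q ^ 2) - f`_2 ^+ (q ^ n) * u`_n)).
  rewrite coef_mul_f coef_f_mul.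
  rewrite -subr_eq0 -[RHS]subr_eq0; congr (_ == _); ring.
split=> [E|[r1 r2]].
  by split=> [|n]; apply/eqP; rewrite -?e1 -?e2 E.
apply: (@polyP K (_ : {poly K}) _).1 => -[|[|n]].
- by rewrite !coef0_tmul mulrC.
- by apply/eqP; rewrite e1 r1.
- by apply/eqP; rewrite e2 r2.
Qed.

End Commutation.

Lemma tau_rec_exists (t g1 g2 x : K) : (forall n, (0 < n)%N -> t ^+ (q ^ n) - t != 0) ->
  exists y : nat -> K, y 0%N = x /\ tau_rec t g1 g2 y.
Proof.
move=> tq.
(* The state after n steps is the pair (y_n, y_{n+1}). *)
pose next n (ab : K * K) := (ab.2, (g1 * ab.2 ^+ q - g1 ^+ (q ^ n.+1) * ab.2
    + (g2 * ab.1 ^+ (q ^ 2) - g2 ^+ (q ^ n) * ab.1)) / (t ^+ (q ^ n.+2) - t)).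
pose y2 := fix y2 n := if n is m.+1 then next m (y2 m) else
  (x, (g1 * x ^+ q - g1 * x) / (t ^+ q - t)).
exists (fun n => (y2 n).1); split=> //; split=> [|n] /=.
  by rewrite divfK // -[q]expn1 tq.
by rewrite divfK ?tq.
Qed.

(** The recurrence has order two and y_{n+2} enters with a nonzero factor, so two consecutive zeros
    propagate. This is why both indices m + 1 and m + 2 are needed. *)
Lemma tau_rec_vanish t g1 g2 (y : nat -> K) m :
    (forall n, (0 < n)%N -> t ^+ (q ^ n) - t != 0) ->
    tau_rec t g1 g2 y -> y m.+1 = 0 -> y m.+2 = 0 ->
  forall n, (m < n)%N -> y n = 0.
Proof.
move=> tq [_ r] y1 y2 n /subnKC <-; move: (n - m.+1)%N => {}n.
suff: y (m.+1 + n)%N = 0 /\ y (m.+1 + n).+1 = 0 by case.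
elim: n => [|n [IH1 IH2]]; first by rewrite addn0.
rewrite addnS; split=> //; have := r (m.+1 + n)%N.
have z1 : 0 ^+ q = 0 :> K := exprq0 k K 1.
rewrite IH1 IH2 z1 (exprq0 k) !mulr0 !subr0 addr0.
by move/eqP; rewrite mulf_eq0 (negPf (tq _ _)) // orbF => /eqP.
Qed.

(* The denominators of the solution of [tau_rec], for coefficients with common
   denominator [g]. *)
Fixpoint rec_den (g : {poly k}) n : {poly k} :=
  if n is m.+1 then ('X^(q ^ m.+1) - 'X) * g ^+ (q ^ m) * rec_den g m ^+ q else 1.

Lemma rec_denS g n :
  rec_den g n.+1 = ('X^(q ^ n.+1) - 'X) * g ^+ (q ^ n) * rec_den g n ^+ q.
Proof. by []. Qed.

(** In [rec_den g n.+2] the factor T^(q^(n+2)) - T absorbs that of the recurrence, the power of g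
    clears the coefficients, and the q-th power goes with y_{n+1}^q. Nothing is divided by, so the
    identity also holds in the residue field, where T^(q^n) - T may vanish. *)
Lemma rec_den_step (g G1 G2 : {poly k}) g1 g2 (y : nat -> K) n :
    gamma g * g1 = gamma G1 -> gamma g * g2 = gamma G2 ->
    tau_rec (gamma 'X) g1 g2 y ->
  gamma (rec_den g n.+2) * y n.+2 =
    gamma (g ^+ (q ^ n.+1).-1 * G1) * (gamma (rec_den g n.+1) * y n.+1) ^+ q
    - gamma (G1 ^+ (q ^ n.+1) * rec_den g n.+1 ^+ q.-1)
        * (gamma (rec_den g n.+1) * y n.+1)
    + (gamma (g ^+ (q ^ n.+1).-1 * G2 * (('X^(q ^ n.+1) - 'X) * g ^+ (q ^ n)) ^+ q)
        * (gamma (rec_den g n) * y n) ^+ (q ^ 2)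
    - gamma (g ^+ (q ^ n.+1 - q ^ n) * G2 ^+ (q ^ n)
        * (('X^(q ^ n.+1) - 'X) * g ^+ (q ^ n)) ^+ q * rec_den g n ^+ (q ^ 2).-1)
        * (gamma (rec_den g n) * y n)).
Proof.
move=> E1 E2 [_ r].
have q0 : (0 < q)%N := ltnW (finNzRing_gt1 k).
have predE (z : K) e : (0 < e)%N -> z ^+ e = z ^+ e.-1 * z.
  by move=> e0; rewrite -exprSr prednK.
pose N := (q ^ n.+1)%N; pose M := (q ^ n)%N.
have N0 : (0 < N)%N by rewrite expn_gt0 q0.
have le_MN : (M <= N)%N by rewrite leq_exp2l ?finNzRing_gt1.
rewrite rec_denS -/N; have := rec_denS g n; rewrite -/N -/M.
move: (rec_den g n.+1) (rec_den g n) => D1 D0.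
move: (('X^N - 'X) * g ^+ M) => C ED1.
rewrite !(rmorphM gamma) !(rmorphXn gamma) rmorphB rmorphXn.
transitivity (gamma g ^+ N * gamma D1 ^+ q * (y n.+2 * (gamma 'X ^+ (q ^ n.+2) - gamma 'X))).
  by ring.
rewrite r -/N -/M.
have e1 : gamma g ^+ N * g1 = gamma g ^+ N.-1 * gamma G1 by rewrite predE // -mulrA E1.
have e2 : gamma g ^+ N * g1 ^+ N = gamma G1 ^+ N by rewrite -exprMn E1.
have e3 : gamma g ^+ N * g2 = gamma g ^+ N.-1 * gamma G2 by rewrite predE // -mulrA E2.
have e4 : gamma g ^+ N * g2 ^+ M = gamma g ^+ (N - M) * gamma G2 ^+ M.
  by rewrite -E2 exprMn mulrA -exprD subnK.
have d1 : gamma D1 ^+ q = gamma D1 ^+ q.-1 * gamma D1 by apply: predE.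
have d0 : gamma D1 ^+ q = gamma C ^+ q * gamma D0 ^+ (q ^ 2).
  by rewrite ED1 rmorphM rmorphXn exprMn -exprM expnSr expn1.
have d2 : gamma D0 ^+ (q ^ 2) = gamma D0 ^+ (q ^ 2).-1 * gamma D0.
  by apply: predE; rewrite expn_gt0 q0.
rewrite !exprMn; set Q := (q ^ 2)%N in d0 d2 *.
transitivity ((gamma g ^+ N * g1) * gamma D1 ^+ q * y n.+1 ^+ q
  - (gamma g ^+ N * g1 ^+ N) * gamma D1 ^+ q * y n.+1
  + ((gamma g ^+ N * g2) * gamma D1 ^+ q * y n ^+ Q
  - (gamma g ^+ N * g2 ^+ M) * gamma D1 ^+ q * y n)); first by ring.
rewrite e1 e2 e3 e4; congr (_ - _ + (_ - _)).
- by ring.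
- by rewrite d1; ring.
- by rewrite d0; ring.
- by rewrite d0 d2; ring.
Qed.

Lemma rec_den_step1 (g G1 : {poly k}) g1 g2 (y : nat -> K) :
    gamma g * g1 = gamma G1 -> tau_rec (gamma 'X) g1 g2 y ->
  gamma (rec_den g 1) * y 1%N =
    gamma G1 * (gamma (rec_den g 0) * y 0%N) ^+ q
    - gamma G1 * (gamma (rec_den g 0) * y 0%N).
Proof.
move=> E1 [r _]; rewrite rec_denS expn1 expn0 [rec_den g 0]/= expr1n mulr1 expr1.
rewrite rmorphM rmorphB rmorphXn rmorph1 !mul1r -E1.
transitivity (gamma g * (y 1%N * (gamma 'X ^+ q - gamma 'X))); first by ring.
by rewrite r; ring.
Qed.

Lemma rec_den_neq0 (g : {poly k}) n : g != 0 -> rec_den g n != 0.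
Proof.
move=> g0; elim: n => [|n IH]; first exact: oner_neq0.
have q1 := finNzRing_gt1 k.
rewrite rec_denS !mulf_neq0 ?expf_neq0 // subr_eq0; apply/eqP => E.
have := congr1 (fun p : {poly k} => size p) E; rewrite size_polyXn size_polyX => -[E1].
by have := ltn_expl n.+1 q1; rewrite E1.
Qed.

Lemma size_polyXqBX n : (size ('X^(q ^ n) - 'X : {poly k})%R <= 2 * q ^ n)%N.
Proof.
have q0 : (0 < q ^ n)%N by rewrite expn_gt0 (ltnW (finNzRing_gt1 k)).
rewrite (leq_trans (size_polyD _ _)) // size_polyN size_polyXn size_polyX geq_max; lia.
Qed.

End Recurrence.

Lemma size_polyM_leq (R : nzRingType) (a b : {poly R}) m n :
  (size a <= m)%N -> (size b <= n)%N -> (size (a * b)%R <= m + n)%N.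
Proof.
move=> sa sb; apply: leq_trans (size_polyMleq a b) _.
by apply: leq_trans (leq_pred _) _; apply: leq_add.
Qed.

(** Cruder than (h - 1) n + 1, but free of subtractions; [0 < n] covers e = 0, where the power is
    1. *)
Lemma size_polyX_leq (R : nzRingType) (a : {poly R}) h e n :
  (size a <= h)%N -> (0 < h)%N -> (e <= n)%N -> (0 < n)%N -> (size (a ^+ e)%R <= h * n)%N.
Proof.
move=> sa h0 le_en n0; apply: leq_trans (size_poly_exp_leq a e) _.
have : ((size a).-1 * e <= h.-1 * n)%N by apply: leq_mul => //; lia.
by nia.
Qed.

Lemma size_mul_le (k : fieldType) (p p' : {poly k}) : (size (p * p')%R <= size p + size p')%N.
Proof. exact: size_polyM_leq. Qed.

Lemma size_add_le (k : fieldType) (p p' : {poly k}) :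
  (size (p + p')%R <= maxn (size p) (size p'))%N.
Proof. exact: size_polyD. Qed.

(* [lia] may treat convertible occurrences of the same size as distinct atoms. *)
Ltac size_lia :=
  repeat match goal with H : context [size _] |- _ => revert H end;
  repeat match goal with |- context [@size ?T ?s] => move: (@size T s) => ? end; lia.

(** * Common lifts to A[X]/(X^2 - b X - a) *)

Section Lift.
Variables (k L K : fieldType) (gL : {rmorphism {poly k} -> L}) (gK : {rmorphism {poly k} -> K}).
Variables (u : L) (x : K) (M : nat).

(* [y] and [z] are the images of a common element r + s X of A[X]/(X^2 - b X - a);
   the shift by [M] makes the height [w] subadditive under products. *)
Definition coimage w (y : L) (z : K) := exists r s : {poly k},
  [/\ (size r + M <= w)%N, (size s + M <= w)%N, y = gL r + gL s * u & z = gK r + gK s * x].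

Lemma coimage_le w w' y z : (w <= w')%N -> coimage w y z -> coimage w' y z.
Proof.
move=> ww [r [s [sr ss -> ->]]]; exists r, s.
by split=> //; rewrite (leq_trans _ ww).
Qed.

Lemma coimage_gen : coimage M.+1 u x.
Proof.
exists 0, 1; rewrite size_poly0 size_poly1 !rmorph0 !rmorph1 !add0r !mul1r.
by split.
Qed.

Lemma coimage_add w y z y' z' : coimage w y z -> coimage w y' z' -> coimage w (y + y') (z + z').
Proof.
move=> [r [s [sr ss -> ->]]] [r' [s' [sr' ss' -> ->]]]; exists (r + r'), (s + s').
split; try by rewrite rmorphD rmorphD; ring.
- by have := size_add_le r r'; size_lia.
- by have := size_add_le s s'; size_lia.
Qed.

Lemma coimage_scale (c : {poly k}) w y z :
  coimage w y z -> coimage (size c + w)%N (gL c * y) (gK c * z).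
Proof.
move=> [r [s [sr ss -> ->]]]; exists (c * r), (c * s).
split; try by rewrite !rmorphM; ring.
- by have := size_mul_le c r; size_lia.
- by have := size_mul_le c s; size_lia.
Qed.

Lemma coimage_opp w y z : coimage w y z -> coimage w (- y) (- z).
Proof.
move=> [r [s [sr ss -> ->]]]; exists (- r), (- s).
by rewrite !size_polyN !rmorphN; split=> //; ring.
Qed.

Variables a b : {poly k}.
Hypothesis u2 : u * u = gL a + gL b * u.
Hypothesis x2 : x * x = gK a + gK b * x.
Hypothesis sa : (size a <= M)%N.
Hypothesis sb : (size b <= M)%N.

(** Replacing X^2 by b X + a costs one factor a or b of size at most M. One of the two shifts by M
    pays for it and the other remains. *)
Lemma coimage_mul w w' y z y' z' : coimage w y z -> coimage w' y' z' ->
  coimage (w + w')%N (y * y') (z * z').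
Proof.
move=> [r [s [sr ss -> ->]]] [r' [s' [sr' ss' -> ->]]].
exists (r * r' + s * s' * a), (r * s' + s * r' + s * s' * b).
split.
- have := size_add_le (r * r') (s * s' * a); have := size_mul_le r r'; have := size_mul_le s s'.
  by have := size_mul_le (s * s') a; size_lia.
- have := size_add_le (r * s' + s * r') (s * s' * b); have := size_add_le (r * s') (s * r').
  have := size_mul_le r s'; have := size_mul_le s r'; have := size_mul_le s s'.
  by have := size_mul_le (s * s') b; size_lia.
- rewrite !rmorphD !rmorphM; move: u2 => E.
  transitivity (gL r * gL r' + (gL r * gL s' + gL s * gL r') * u
    + gL s * gL s' * (u * u)); first by ring.
  by rewrite E; ring.
- rewrite !rmorphD !rmorphM; move: x2 => E.
  transitivity (gK r * gK r' + (gK r * gK s' + gK s * gK r') * x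
    + gK s * gK s' * (x * x)); first by ring.
  by rewrite E; ring.
Qed.

Lemma coimage_exp w y z n : (0 < n)%N -> coimage w y z -> coimage (w * n)%N (y ^+ n) (z ^+ n).
Proof.
case: n => // n _ yz; elim: n => [|n IH]; first by rewrite muln1 !expr1.
by rewrite mulnS !(exprS _ n.+1); apply: coimage_mul.
Qed.

End Lift.

Section LiftRec.
Variables (k : finFieldType) (g G1 G2 : {poly k}) (h : nat).
Local Notation q := #|k|.
Hypotheses (h0 : (0 < h)%N) (sg : (size g <= h)%N).
Hypotheses (sG1 : (size G1 <= h)%N) (sG2 : (size G2 <= h)%N).

(** Each step multiplies the size by q and adds at most (2 + h) q^(n+1), whence the factor linear in
    n. *)
Lemma size_rec_den n : (size (rec_den g n) <= q ^ n * (1 + (2 + h) * n))%N.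
Proof.
have q1 : (1 < q)%N := finNzRing_gt1 k.
elim: n => [|n IH]; first by rewrite expn0 muln0 !size_poly1.
have M0 : (0 < q ^ n)%N by rewrite expn_gt0 ltnW.
rewrite rec_denS; set D := rec_den g n in IH *.
apply: leq_trans (_ : (2 * q ^ n.+1 + h * q ^ n + (q ^ n * (1 + (2 + h) * n)) * q <= _)%N).
  apply: size_polyM_leq; last first.
    by apply: size_polyX_leq => //; [rewrite muln_gt0 M0 | exact: ltnW].
  apply: size_polyM_leq; first exact: size_polyXqBX.
  exact: size_polyX_leq.
have hq : (h * q ^ n <= q * (h * q ^ n))%N by rewrite leq_pmull // ltnW.
rewrite expnS; move: (q ^ n)%N M0 hq => N N0 hq; clear -hq.
by rewrite mulnS; move: hq; nia.
Qed.

Variables (L K : fieldType) (gL : {rmorphism {poly k} -> L}) (gK : {rmorphism {poly k} -> K}).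
Variables (a b : {poly k}) (M : nat) (l1 l2 : L) (k1 k2 : K) (y : nat -> L) (z : nat -> K).
Hypotheses (sa : (size a <= M)%N) (sb : (size b <= M)%N).
Hypothesis y2 : y 0%N * y 0%N = gL a + gL b * y 0%N.
Hypothesis z2 : z 0%N * z 0%N = gK a + gK b * z 0%N.
Hypotheses (El1 : gL g * l1 = gL G1) (El2 : gL g * l2 = gL G2).
Hypotheses (Ek1 : gK g * k1 = gK G1) (Ek2 : gK g * k2 = gK G2).
Hypothesis yrec : tau_rec k (gL 'X) l1 l2 y.
Hypothesis zrec : tau_rec k (gK 'X) k1 k2 z.

Local Notation coimage := (coimage gL gK (y 0%N) (z 0%N) M).
Local Notation W n := (q ^ n * (1 + M + (2 + h) * n))%N.

Let coimage_sub w s t s' t' : coimage w s t -> coimage w s' t' -> coimage w (s - s') (t - t').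
Proof. by move=> st st'; apply: coimage_add => //; apply: coimage_opp. Qed.

Let coimage_scale_le (c : {poly k}) m w w' s t : (size c <= m)%N -> (m + w <= w')%N ->
  coimage w s t -> coimage w' (gL c * s) (gK c * t).
Proof.
move=> sc mw st; apply: coimage_le (coimage_scale c st).
by apply: leq_trans mw; rewrite leq_add2r.
Qed.

(** Two consecutive indices are carried along because the recurrence has order two. The identities
    over L and K have the same coefficients in A, so they act on one common r + s X. The initial
    height [W 0] = 1 + M is that of X. *)
Lemma coimage_rec_pair n :
  coimage (W n) (gL (rec_den g n) * y n) (gK (rec_den g n) * z n) /\
  coimage (W n.+1) (gL (rec_den g n.+1) * y n.+1) (gK (rec_den g n.+1) * z n.+1).
Proof.
have q1 : (1 < q)%N := finNzRing_gt1 k.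
have q0 : (0 < q)%N := ltnW q1.
elim: n => [|n [IH0 IH1]].
  have H0 : coimage (W 0) (gL (rec_den g 0) * y 0%N) (gK (rec_den g 0) * z 0%N).
    rewrite !rmorph1 !mul1r; apply: coimage_le (coimage_gen _ _ _ _ _).
    by rewrite expn0 muln0 addn0 mul1n.
  split=> //; rewrite (rec_den_step1 El1 yrec) (rec_den_step1 Ek1 zrec).
  rewrite expn0 muln0 addn0 mul1n in H0; rewrite expn1 muln1.
  have hq : (h <= q * h)%N by rewrite leq_pmull.
  apply: coimage_sub.
    apply: coimage_scale_le sG1 _ (coimage_exp y2 z2 sa sb q0 H0).
    by move: hq; clear; nia.
  apply: coimage_scale_le sG1 _ H0.
  by move: hq q0; clear; nia.
split=> //.
rewrite (rec_den_step n El1 El2 yrec) (rec_den_step n Ek1 Ek2 zrec).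
have D0 := size_rec_den n; have D1 := size_rec_den n.+1.
pose N' := (q ^ n)%N; pose N := (q * N')%N.
have N'0 : (0 < N')%N by rewrite expn_gt0 q0.
have N0 : (0 < N)%N by rewrite muln_gt0 q0.
have E1 : (q ^ n.+1)%N = N by rewrite expnS.
have E2 : (q ^ n.+2)%N = (q * N)%N by rewrite !expnS.
have sC : (size (('X^N - 'X) * g ^+ N')%R <= 2 * N + h * N')%N.
  apply: size_polyM_leq; last exact: size_polyX_leq.
  by rewrite -E1 size_polyXqBX.
have sCq : (size ((('X^N - 'X) * g ^+ N') ^+ q)%R <= (2 * N + h * N') * q)%N.
  by apply: size_polyX_leq => //; rewrite addn_gt0 muln_gt0 N0.
(* Besides the factor q, the height grows by (2 + h) q N from n + 1 to n + 2; as q >= 2, the part q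
   h N has room for two coefficients of size h N. *)
have hN : (2 * (h * N) <= q * (h * N))%N by rewrite leq_mul2r q1 orbT.
rewrite E1 -/N' in IH0 IH1 D0 D1 *; rewrite E2.
set V0 := gL (rec_den g n) * _ in IH0 *; set Z0 := gK (rec_den g n) * _ in IH0 *.
set V1 := gL (rec_den g n.+1) * _ in IH1 *; set Z1 := gK (rec_den g n.+1) * _ in IH1 *.
have Q0 : (0 < q ^ 2)%N by rewrite expn_gt0 q0.
have EQ : (q ^ 2)%N = (q * q)%N by [].
apply: coimage_add; apply: coimage_sub.
- apply: coimage_scale_le (_ : (_ <= h * N + h)%N) _ (coimage_exp y2 z2 sa sb q0 IH1).
    by apply: size_polyM_leq => //; apply: size_polyX_leq => //; apply: leq_pred.
  have : (h <= h * N)%N by rewrite leq_pmulr.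
  by move: hN; clear; nia.
- have D1p : (0 < N * (1 + (2 + h) * n.+1))%N by rewrite muln_gt0 N0.
  have qp : (0 < q.-1)%N by rewrite -ltnS prednK.
  apply: coimage_scale_le (_ : (_ <= h * N + N * (1 + (2 + h) * n.+1) * q.-1)%N) _ IH1.
    by apply: size_polyM_leq; apply: size_polyX_leq.
  have : (q = q.-1.+1)%N by rewrite prednK.
  move: hN; move: q.-1 => q' + qE; rewrite qE; clear; nia.
- apply: coimage_scale_le (_ : (_ <= (h * N + h) + (2 * N + h * N') * q)%N) _
    (coimage_exp y2 z2 sa sb Q0 IH0).
    apply: size_polyM_leq => //.
    by apply: size_polyM_leq => //; apply: size_polyX_leq => //; apply: leq_pred.
  have : (h <= h * N)%N by rewrite leq_pmulr.
  rewrite EQ /N in hN *; move: hN; clear; nia.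
- have D0p : (0 < N' * (1 + (2 + h) * n))%N by rewrite muln_gt0 N'0.
  have Qp : (0 < (q ^ 2).-1)%N by rewrite -ltnS prednK // EQ; clear -q1; nia.
  have NN : (N - N' <= N)%N by apply: leq_subr.
  apply: coimage_scale_le (_ : (_ <= (h * N + h * N') + (2 * N + h * N') * q
     + N' * (1 + (2 + h) * n) * (q ^ 2).-1)%N) _ IH0.
    apply: size_polyM_leq; last exact: size_polyX_leq.
    apply: size_polyM_leq => //.
    by apply: size_polyM_leq => //; apply: size_polyX_leq.
  have : (h * N' <= h * N)%N by rewrite leq_mul // /N leq_pmull.
  have : (q * q = (q ^ 2).-1.+1)%N by rewrite prednK.
  move: (q ^ 2).-1 => Q' QE; rewrite /N in hN *; move: hN QE; clear; nia.
Qed.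

Lemma coimage_rec n : coimage (W n) (gL (rec_den g n) * y n) (gK (rec_den g n) * z n).
Proof. by have [] := coimage_rec_pair n. Qed.

End LiftRec.

(** * Extension of scalars for twisted polynomials *)

Section Extension.
Variables (k : finFieldType) (L L' : fieldType) (gamma : {rmorphism {poly k} -> L}).
Variable iota : {rmorphism L -> L'}.
Local Notation q := #|k|.

Lemma coef_tpoly_ext (u : tpoly gamma) n : (tpoly_ext iota u)`_n = iota u`_n.
Proof. exact: coef_map. Qed.

Lemma tpoly_extD (u v : tpoly gamma) :
  tpoly_ext iota (u + v) = tpoly_ext iota u + tpoly_ext iota v.
Proof.
apply: (@polyP L' (_ : {poly L'}) _).1 => n.
by rewrite coef_tD !coef_tpoly_ext coef_tD rmorphD.
Qed.

Lemma tpoly_extM (u v : tpoly gamma) :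
  tpoly_ext iota (u * v) = tpoly_ext iota u * tpoly_ext iota v.
Proof.
apply: (@polyP L' (_ : {poly L'}) _).1 => n.
rewrite coef_tpoly_ext !coef_tmul rmorph_sum; apply: eq_bigr => i _.
by rewrite !coef_tpoly_ext rmorphM rmorphXn.
Qed.

Lemma tpoly_extC c : tpoly_ext iota (c *: (1 : tpoly gamma)) = c *: 1.
Proof.
apply: (@polyP L' (_ : {poly L'}) _).1 => n; rewrite coef_tpoly_ext.
transitivity (iota (gamma c%:P * (1 : {poly L})`_n)).
  by congr (iota _); apply: (coefZ _ (1 : {poly L})).
transitivity (iota (gamma c%:P) * (1 : {poly L'})`_n).
  by rewrite rmorphM !coefC; case: ifP => _; rewrite ?rmorph1 ?rmorph0.
by rewrite -(coefZ _ (1 : {poly L'})).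
Qed.

Lemma Drinfeld_EndP (psi : {lrmorphism {poly k} -> tpoly gamma})
    (u : tpoly (iota \o gamma)) :
  u * tpoly_ext iota (psi 'X) = tpoly_ext iota (psi 'X) * u -> Drinfeld_End psi u.
Proof.
move=> uT; elim/poly_ind => [|a c IH].
  have e0 : tpoly_ext iota (psi 0) = 0.
    by apply: (@polyP L' (_ : {poly L'}) _).1 => n; rewrite coef_tpoly_ext rmorph0 !coef0 rmorph0.
  by rewrite e0 mulr0 mul0r.
rewrite phi_MXaddC tpoly_extD tpoly_extM tpoly_extC mulrDr mulrDl !mulrA IH -!mulrA uT.
by congr (_ + _); rewrite -scalerAr -scalerAl mulr1 mul1r.
Qed.

End Extension.

(** * Endomorphisms of the reduction outside phi(A) have large degree *)

Section Bound.
Variables (k : finFieldType) (psi : {lrmorphism {poly k} -> tpoly (gammaF k)}).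
Variables (Falg : closedFieldType) (iota : {rmorphism {fraction {poly k}} -> Falg}).
Local Notation q := #|k|.
Hypothesis psi0 : (psi 'X)`_0 = gammaF k 'X.
Hypothesis spsi : size (psi 'X) = 3%N.
Hypothesis End_psi : forall u : tpoly (iota \o gammaF k),
     Drinfeld_End psi u -> exists a, u = tpoly_ext iota (psi a).
Variables (g G1 G2 : {poly k}) (h : nat).
Hypotheses (g0 : g != 0) (h0 : (0 < h)%N) (sg : (size g <= h)%N).
Hypotheses (sG1 : (size G1 <= h)%N) (sG2 : (size G2 <= h)%N).
Hypothesis psi1 : gammaF k g * (psi 'X)`_1 = gammaF k G1.
Hypothesis psi2 : gammaF k g * (psi 'X)`_2 = gammaF k G2.

Variables (L : fieldType) (gamma : {rmorphism {poly k} -> L}).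
Variable phi : {lrmorphism {poly k} -> tpoly gamma}.
Hypothesis phi0 : (phi 'X)`_0 = gamma 'X.
Hypothesis sphi : size (phi 'X) = 3%N.
Hypothesis phi1 : gamma g * (phi 'X)`_1 = gamma G1.
Hypothesis phi2 : gamma g * (phi 'X)`_2 = gamma G2.
Variable P : nat.
Hypothesis size_ker : forall b : {poly k}, gamma b = 0 -> b != 0 -> (P < size b)%N.

(** The bound is twice the height of the lift at index m + 2, with M = 2 m + 1. If P reached it, a
    norm from index m + 1 or m + 2 in the kernel of [gamma] would be too small to be nonzero. *)
Lemma endomorphism_bound (u : tpoly gamma) m : u * phi 'X = phi 'X * u ->
    ~ is_scalar phi u -> size u = m.+1 ->
  forall a b : {poly k}, u * u = phi a + phi b * u ->
  (size a <= m.*2.+1)%N -> (size b <= m.*2.+1)%N ->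
  (P < 2 * (q ^ m.+2 * (1 + m.*2.+1 + (2 + h) * m.+2)))%N.
Proof.
move=> uT uN su a b uu sa sb; rewrite ltnNge; apply/negP => leP.
pose gK : {rmorphism {poly k} -> Falg} := iota \o gammaF k.
have gK_eq0 c : (gK c == 0) = (c == 0).
  by rewrite /gK /= fmorph_eq0 tofrac_eq0.
have tq n : (0 < n)%N -> gK 'X ^+ (q ^ n) - gK 'X != 0.
  move=> n0; rewrite -rmorphXn -rmorphB gK_eq0 subr_eq0; apply/eqP => E.
  have := congr1 (fun p : {poly k} => size p) E; rewrite size_polyXn size_polyX => -[E1].
  by have := ltn_expl n (finNzRing_gt1 k); rewrite E1; case: n n0 E E1.
have [x x2] : exists x : Falg, x * x = gK a + gK b * x.
  have [x Ex] := @solve_monicpoly Falg 2 (fun i => if i == 0%N then gK a else gK b) isT.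
  exists x; rewrite -expr2 Ex !big_ord_recl big_ord0 /= addr0 expr0 mulr1.
  by rewrite /bump /= expr1.
have [z [z0 zrec]] := tau_rec_exists (iota (psi 'X)`_1) (iota (psi 'X)`_2) x tq.
have yrec : tau_rec k (gamma 'X) (phi 'X)`_1 (phi 'X)`_2 (fun n => u`_n).
  by rewrite -phi0; apply/comm_tau_rec => //; rewrite sphi.
have u2 : u`_0 * u`_0 = gamma a + gamma b * u`_0.
  have := congr1 (fun v : tpoly gamma => v`_0) uu.
  by rewrite coef_tD !coef0_tmul !(coef0_phi phi0).
rewrite -z0 in x2.
have k1 : gK g * iota (psi 'X)`_1 = gK G1 by rewrite /gK /= -rmorphM psi1.
have k2 : gK g * iota (psi 'X)`_2 = gK G2 by rewrite /gK /= -rmorphM psi2.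
have lift n := coimage_rec h0 sg sG1 sG2 sa sb u2 x2 phi1 phi2 k1 k2 yrec zrec n.
have van n : (m < n)%N -> (n <= m.+2)%N -> z n = 0.
  move=> lt_mn le_n; have := lift n; rewrite [u`_n]nth_default ?su // mulr0.
  set w := (q ^ n * _)%N => -[r [s [sr ss r0 rz]]].
  have le_w : (2 * w <= P)%N.
    apply: leq_trans leP; rewrite leq_mul2l /= leq_mul //.
      by rewrite leq_exp2l // finNzRing_gt1.
    by rewrite leq_add2l leq_mul2l /=.
  (* The norm of r + s X; [gamma] kills it because r + s u_0 maps to 0 and u_0 is a root of X^2 - b
     X - a. *)
  pose N := r ^+ 2 + r * s * b - s ^+ 2 * a.
  have N0 : N = 0.
    apply/eqP; case: eqVneq => // nzN; have := size_ker _ nzN; rewrite ltnNge.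
    move=> /(_ _)/negP[].
      have Er : gamma r = - (gamma s * u`_0) by apply/eqP; rewrite -addr_eq0 -r0.
      rewrite rmorphB rmorphD !(rmorphM, rmorphXn) Er.
      transitivity (gamma s ^+ 2 * (u`_0 * u`_0 - (gamma a + gamma b * u`_0))); first by ring.
      by rewrite u2 subrr mulr0.
    apply: leq_trans le_w; rewrite /N !expr2.
    have := size_add_le (r * r + r * s * b) (- (s * s * a)); rewrite size_polyN.
    have := size_add_le (r * r) (r * s * b); have := size_mul_le r r; have := size_mul_le (r * s) b.
    have := size_mul_le r s; have := size_mul_le (s * s) a; have := size_mul_le s s.
    move: sr ss sa sb; clear; size_lia.
  have s0 : s = 0 by apply: (norm_form_eq0 sphi uT uN uu N0).
  have r00 : r = 0.
    by apply/eqP; rewrite -sqrf_eq0 -N0 /N s0 !(mul0r, mulr0, expr0n) addr0 subr0.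
  move/eqP: rz; rewrite r00 s0 !rmorph0 mul0r addr0 mulf_eq0 gK_eq0.
  by rewrite (negPf (rec_den_neq0 n g0)) /= => /eqP.
have zv := tau_rec_vanish tq zrec (van m.+1 (ltnSn _) (leqnSn _)) (van m.+2 (leqnSn _) (leqnn _)).
(* The truncation loses nothing, since z vanishes beyond m. *)
pose v : tpoly (iota \o gammaF k) := \poly_(i < m.+1) z i.
have vz n : v`_n = z n by rewrite coef_poly; case: ltnP => // /zv->.
have [] := @End_psi v.
  apply: Drinfeld_EndP; apply/comm_tau_rec.
    by apply: leq_trans (size_poly _ _) _; rewrite spsi.
  rewrite !coef_tpoly_ext psi0.
  case: zrec => zr1 zr2; split=> [|n]; first by rewrite !vz.
  by rewrite !vz; apply: zr2.
move=> a0 /(congr1 (fun w : tpoly (iota \o gammaF k) => w`_0)).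
rewrite vz coef_tpoly_ext (coef0_phi psi0) => Ez; have Ez0 : z 0%N = gK a0 := Ez.
(* The root z_0 is the image of a0, so X - a0 has norm zero, which is excluded as its coefficient s
   is 1. *)
have N1 : (- a0) ^+ 2 + (- a0) * 1 * b - 1 ^+ 2 * a = 0.
  apply/eqP; rewrite -gK_eq0 rmorphB rmorphD !(rmorphM, rmorphXn) rmorphN rmorph1 -Ez0.
  apply/eqP; transitivity (z 0%N * z 0%N - (gK a + gK b * z 0%N)); first by ring.
  by rewrite x2 subrr.
by have /eqP := norm_form_eq0 sphi uT uN uu N1; rewrite oner_eq0.
Qed.

End Bound.

(** * Good reduction *)

Section Fractions.
Variable k : fieldType.
Local Notation F := {fraction {poly k}}.
Implicit Types (x : F) (p a : {poly k}).

Lemma tofrac_repr x : gammaF k \d_(repr x) * x = gammaF k \n_(repr x).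
Proof.
rewrite -{2}[x]reprK /gammaF /=; set r := repr x.
apply/eqP; rewrite !piE /FracField.equivf /FracField.mulf.
have r0 := denom_ratioP r.
by rewrite !numden_Ratio ?oner_eq0 ?mul1r ?mulr1 // mulrC.
Qed.

Lemma frac_den_neq0 x : frac_den x != 0.
Proof.
have r0 := denom_ratioP (repr x).
by rewrite /frac_den dvdp_div_eq0 ?dvdp_gcdr.
Qed.

Lemma coprimep_frac x : coprimep (frac_num x) (frac_den x).
Proof. by rewrite coprimep_div_gcd // denom_ratioP orbT. Qed.

Lemma frac_denM x : gammaF k (frac_den x) * x = gammaF k (frac_num x).
Proof.
have r0 := denom_ratioP (repr x).
pose c := gcdp \n_(repr x) \d_(repr x).
have c0 : gammaF k c != 0 by rewrite tofrac_eq0 gcdp_eq0 negb_and r0 orbT.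
apply: (mulIf c0); rewrite mulrAC -!rmorphM /frac_den /frac_num.
by rewrite !divpK ?dvdp_gcdl ?dvdp_gcdr // tofrac_repr.
Qed.

Lemma poly_ord_gt0 p a : (1 < size p)%N -> a != 0 -> p %| a -> (0 < poly_ord p a)%N.
Proof.
move=> sp a0 pa; have lt1 : (1 < size a)%N by apply: leq_trans sp (dvdp_leq a0 pa).
by apply: (@leq_trans (Ordinal lt1)) => //; apply: leq_bigmax_cond; rewrite /= expr1.
Qed.

Lemma poly_ord_ndvd p a : ~~ (p %| a) -> poly_ord p a = 0%N.
Proof.
move=> pa; apply/eqP; rewrite -leqn0; apply/bigmax_leqP => -[[|i] lti] //= pia.
by case/negP: pa; apply: dvdp_trans pia; rewrite exprS dvdp_mulr.
Qed.

(** Numerator and denominator are coprime, so if p divided the denominator, it would not divide the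
    numerator and [ord] would be negative. *)
Lemma ord_ge0_ndvd p x : (1 < size p)%N -> (x != 0) ==> (0 <= ord p x)%R ->
  ~~ (p %| frac_den x).
Proof.
move=> sp hx; apply/negP => pd.
have pn : ~~ (p %| frac_num x).
  apply/negP => pn; have := coprimep_frac x; rewrite coprimep_def => /eqP c1.
  have : p %| gcdp (frac_num x) (frac_den x) by rewrite dvdp_gcd pn.
  move/dvdp_leq; rewrite -size_poly_eq0 c1 => /(_ isT).
  by rewrite leqNgt sp.
(* For x = 0 the hypothesis on [ord] is void, but the numerator is then 0, which p divides. *)
have [x0|x0] := eqVneq x 0.
  move: pn; have := frac_denM x; rewrite {2}x0 mulr0 => /esym/eqP.
  by rewrite tofrac_eq0 => /eqP->; rewrite dvdp0.
have := poly_ord_gt0 sp (frac_den_neq0 x) pd.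
by move: hx; rewrite x0 /ord poly_ord_ndvd //; move: (poly_ord _ _) => -[].
Qed.

Lemma ord_eq0_ndvd p x : (1 < size p)%N -> x != 0 -> ord p x == 0%R ->
  ~~ (p %| frac_num x).
Proof.
move=> sp x0 ord0; have pd : ~~ (p %| frac_den x).
  by apply: ord_ge0_ndvd => //; rewrite (eqP ord0) lexx implybT.
have gx0 : gammaF k (frac_den x) * x != 0.
  by apply: mulf_neq0 x0; rewrite tofrac_eq0; apply: frac_den_neq0.
apply/negP => pn; have n0 : frac_num x != 0.
  by apply: contra_neq gx0 => n0; rewrite frac_denM n0 rmorph0.
have := poly_ord_gt0 sp n0 pn.
by move: ord0; rewrite /ord (poly_ord_ndvd pd) subr0; move: (poly_ord _ _) => -[].
Qed.

Section Residue.
Variables (p : {poly k}) (hp : monic_irreducible_poly p).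

Lemma residue_eq0 a : (residue hp a == 0) = (p %| a).
Proof.
rewrite /dvdp (Pdiv.IdomainMonic.modpE hp.2) -[LHS](inj_eq val_inj) /=.
by rewrite (mk_monicE hp).
Qed.

Lemma frac_residueM x : ~~ (p %| frac_den x) ->
  residue hp (frac_den x) * frac_residue hp x = residue hp (frac_num x).
Proof.
move=> pd; rewrite /frac_residue mulrC divfK //.
by rewrite residue_eq0.
Qed.

Lemma frac_residue0 : frac_residue hp 0 = 0.
Proof.
have := frac_denM 0; rewrite mulr0 => /esym/eqP; rewrite tofrac_eq0 => /eqP n0.
by rewrite /frac_residue n0 rmorph0 mul0r.
Qed.

Lemma frac_residue_tofrac a : frac_residue hp (gammaF k a) = residue hp a.
Proof.
have /eqP := frac_denM (gammaF k a); rewrite -rmorphM tofrac_eq => /eqP E.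
(* The denominator is determined only up to a unit, so it is shown to be a nonzero constant rather
   than 1. *)
have sd : size (frac_den (gammaF k a)) == 1%N.
  have := coprimep_frac (gammaF k a); rewrite -E => /coprimepP cop.
  by rewrite size_poly_eq1 cop ?dvdp_mulr.
have pd : ~~ (p %| frac_den (gammaF k a)).
  apply/negP => /(dvdp_leq (frac_den_neq0 _)); rewrite (eqP sd).
  by rewrite leqNgt hp.1.1.
apply: (mulfI (_ : residue hp (frac_den (gammaF k a)) != 0)).
  by rewrite residue_eq0.
by rewrite frac_residueM // -rmorphM E.
Qed.

End Residue.
End Fractions.

Section GoodReduction.
Variables (k : finFieldType) (psi : {lrmorphism {poly k} -> tpoly (gammaF k)}).
Hypothesis psi0 : (psi 'X)`_0 = gammaF k 'X.
Hypothesis spsi : size (psi 'X) = 3%N.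
Variables (p : {poly k}) (hp : monic_irreducible_poly p).
Hypothesis good : good_reduction psi p.

Local Notation g1 := (psi 'X)`_1.
Local Notation g2 := (psi 'X)`_2.
Local Notation phi := (reduction psi hp).

Lemma coef_reductionX n : (phi 'X)`_n = frac_residue hp (psi 'X)`_n.
Proof.
rewrite /reduction horner_algX; apply: coef_map_id0.
exact: frac_residue0.
Qed.

Lemma reduction_coef0 : (phi 'X)`_0 = residue hp 'X.
Proof. by rewrite coef_reductionX psi0 frac_residue_tofrac. Qed.

Let den1 : ~~ (p %| frac_den g1).
Proof.
by case/and3P: good => o1 _ _; apply: ord_ge0_ndvd => //; apply: hp.1.1.
Qed.

Let den2 : ~~ (p %| frac_den g2).
Proof.
case/and3P: good => _ _ o2; apply: ord_ge0_ndvd; first exact: hp.1.1.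
by rewrite (eqP o2) lexx implybT.
Qed.

(** Clearing the common denominator, which is prime to p, gives the relation that holds over F with
    the same polynomials of A; one recurrence thus serves both fields. *)
Lemma reduction_coef1 : residue hp (frac_den g1 * frac_den g2) * (phi 'X)`_1
  = residue hp (frac_num g1 * frac_den g2).
Proof. by rewrite coef_reductionX !rmorphM mulrAC frac_residueM. Qed.

Lemma reduction_coef2 : residue hp (frac_den g1 * frac_den g2) * (phi 'X)`_2
  = residue hp (frac_num g2 * frac_den g1).
Proof. by rewrite coef_reductionX !rmorphM -mulrA frac_residueM // mulrC. Qed.

Lemma size_reductionX : size (phi 'X) = 3%N.
Proof.
apply/anti_leq/andP; split.
  apply/leq_sizeP => j le_j; rewrite coef_reductionX nth_default ?spsi //.
  exact: frac_residue0.
apply: coef_neq0_size; case/and3P: good => _ nz2 o2.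
apply/eqP => c0; have := reduction_coef2; rewrite c0 mulr0 => /esym/eqP.
rewrite rmorphM mulf_eq0 !residue_eq0 (negPf den1) orbF.
by apply/negP/ord_eq0_ndvd => //; apply: hp.1.1.
Qed.

Lemma residue_ker_size (b : {poly k}) :
  residue hp b = 0 -> b != 0 -> ((size p).-1 < size b)%N.
Proof.
move=> /eqP; rewrite residue_eq0 => pb b0.
by rewrite prednK ?(dvdp_leq b0) // (ltn_trans _ hp.1.1).
Qed.

End GoodReduction.

Lemma residue_field_card (k : finFieldType) (p : {poly k}) (hp : monic_irreducible_poly p) :
  #|{poly %/ p with hp}| = (#|k| ^ (size p).-1)%N.
Proof. exact: (card_monic_qpoly hp.1.1 hp.2). Qed.

Lemma residue_field_expq (k : finFieldType) (p : {poly k}) (hp : monic_irreducible_poly p)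
  (x : {poly %/ p with hp}) : x ^+ (#|k| ^ (size p).-1) = x.
Proof. by rewrite -(residue_field_card hp) expf_card. Qed.

(** * The bound on d2 *)

Section Growth.
Variable R : realType.
Local Notation expR := (@sequences.expR R).

(** From exp(-1/6) >= 5/6 one gets e <= (6/5)^6 < 3. *)
Lemma expR1_lt3 : expR 1 < 3.
Proof.
have le56 : 5 / 6 <= expR (- 6^-1).
  by apply: le_trans (expR_ge1Dx _); lra.
have E : expR 1 = (expR (- 6^-1)) ^- 6.
  by rewrite -exprVn -expRN opprK -expRM_natl; congr expR; field.
rewrite E; apply: (@le_lt_trans _ _ ((5 / 6) ^- 6)); last by lra.
rewrite lef_pV2 ?posrE ?exprn_gt0 ?expR_gt0 //; last by lra.
by rewrite lerXn2r ?nnegrE ?expR_ge0 //; lra.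
Qed.

(** Here e < 3 <= q. This makes ln ln |p| positive even for deg p = 1. *)
Lemma ln_nat_gt1 q : (2 < q)%N -> 1 < ln (q%:R : R).
Proof.
move=> q3; have q0 : 0 < q%:R :> R by rewrite ltr0n; lia.
rewrite -[X in X < _]expRK ltr_ln ?posrE ?expR_gt0 //.
by apply: lt_le_trans expR1_lt3 _; rewrite ler_nat.
Qed.

(** Squaring, q^(2e) >= q^P q^n, so q^n l^2 has to dominate a multiple of P, where l = ln ln q^P.
    This is immediate if P <= q^n. Otherwise n <= l, and P <= B (n + 1) q^n loses only a factor
    O(l). *)
Lemma growth_bound (q B : nat) : (2 < q)%N -> (0 < B)%N ->
  exists2 C : R, 0 < C & forall P n e : nat, (0 < P)%N ->
    (P <= B * (n.+1 * q ^ n))%N -> (P + n <= e.*2)%N ->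
    C * (q ^ P)%:R `^ 2^-1 * (ln (q ^ P)%:R `^ 2^-1 / ln (ln (q ^ P)%:R))
      <= (q ^ e)%:R.
Proof.
move=> q3 B0; have c1 := ln_nat_gt1 q3; set c := ln q%:R in c1.
have c0 : 0 < c by apply: lt_trans c1.
pose eps := ln c; have eps0 : 0 < eps by apply: ln_gt0.
have BR : 1 <= B%:R :> R by rewrite ler1n.
have B1 : 0 < B%:R * (eps + 1) by apply: mulr_gt0; lra.
(* [eps] is a lower bound for l. The factor eps^2 serves both cases below, eps + 1 comes from eps (n
   + 1) <= l (eps + 1), and c turns ln q^P into P. *)
pose D := eps ^+ 2 / (B%:R * (eps + 1)) / c.
have D0 : 0 < D by rewrite !divr_gt0 // exprn_gt0.
exists (Num.sqrt D); first by rewrite sqrtr_gt0.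
move=> P n e P0 leP le_e.
have PR : 1 <= P%:R :> R by rewrite ler1n.
have Ppos : 0 < P%:R :> R by rewrite ltr0n.
have q0 : 0 < q%:R :> R by rewrite ltr0n; lia.
have q0' : (0 < q)%N := ltnW (ltnW q3).
have S0 : 0 < (q ^ P)%:R :> R by rewrite ltr0n expn_gt0 q0'.
have -> : ln (q ^ P)%:R = P%:R * c by rewrite natrX lnXn ?mulr_natl.
set Y := P%:R * c; have cY : c <= Y by rewrite /Y ler_peMl // ltW.
have Y0 : 0 < Y by apply: lt_le_trans cY.
set l := ln Y; have epsl : eps <= l by rewrite ler_ln.
have l0 : 0 < l by apply: lt_le_trans epsl.
have qn0 : 0 < (q ^ n)%:R :> R by rewrite ltr0n expn_gt0 q0'.
have key : D * Y <= (q ^ n)%:R * l ^+ 2.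
  have -> : D * Y = eps ^+ 2 / (B%:R * (eps + 1)) * P%:R.
    by rewrite /D /Y; field; rewrite !gt_eqF //; lra.
  rewrite mulrAC ler_pdivrMr //.
  have le2 : eps ^+ 2 <= l ^+ 2 by rewrite lerXn2r ?nnegrE // ltW.
  have [lePq|ltqP] := leqP P (q ^ n).
    have lePqR : P%:R <= (q ^ n)%:R :> R by rewrite ler_nat.
    have : eps ^+ 2 * P%:R <= (q ^ n)%:R * l ^+ 2.
      by rewrite mulrC ler_pM ?exprn_ge0 ?ler0n // ltW.
    move/le_trans; apply; rewrite ler_peMr //.
      by rewrite mulr_ge0 ?exprn_ge0 // ltW.
    by rewrite -[1]mulr1 ler_pM //; lra.
  have nl : n%:R <= l.
    have lt1 : ln ((q ^ n)%:R) <= ln (P%:R : R).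
      by rewrite ler_ln ?posrE // ler_nat ltnW.
    have lt2 : ln (P%:R : R) <= l.
      by rewrite ler_ln ?posrE // /Y ler_peMr // ltW.
    move: lt1; rewrite natrX lnXn // -[_ *+ n]mulr_natl -/c => lt1.
    have : n%:R <= n%:R * c :> R by rewrite ler_peMr // ltW.
    by lra.
  have PB : P%:R <= B%:R * ((n%:R + 1) * (q ^ n)%:R) :> R.
    by rewrite natr1 -!natrM ler_nat.
  have n1 : eps * (n%:R + 1) <= l * (eps + 1).
    have : eps * n%:R <= eps * l by rewrite ler_wpM2l // ltW.
    by lra.
  apply: le_trans (_ : eps ^+ 2 * (B%:R * ((n%:R + 1) * (q ^ n)%:R)) <= _).
    by rewrite ler_wpM2l // exprn_ge0 // ltW.
  have e1 : eps * (eps * (n%:R + 1)) <= l * (l * (eps + 1)).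
    by apply: ler_pM => //; [exact: ltW | rewrite mulr_ge0 ?addr_ge0 // ltW].
  have : (B%:R * (q ^ n)%:R) * (eps * (eps * (n%:R + 1)))
       <= (B%:R * (q ^ n)%:R) * (l * (l * (eps + 1))).
    by rewrite ler_wpM2l // mulr_ge0 ?ler0n.
  by rewrite !expr2; lra.
rewrite (powR12_sqrt (ltW S0)) (powR12_sqrt (ltW Y0)).
have e0 : 0 <= (q ^ e)%:R :> R by rewrite ler0n.
rewrite -ler_sqr ?nnegrE //; last first.
  by rewrite !mulr_ge0 ?sqrtr_ge0 ?invr_ge0 // ltW.
rewrite !exprMn exprVn (sqr_sqrtr (ltW D0)) (sqr_sqrtr (ltW S0)) (sqr_sqrtr (ltW Y0)) mulrA.
rewrite ler_pdivrMr ?exprn_gt0 //.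
apply: le_trans (_ : (q ^ P)%:R * ((q ^ n)%:R * l ^+ 2) <= _).
  by rewrite mulrAC mulrC ler_wpM2l ?ler0n // mulrC.
rewrite mulrA ler_wpM2r ?(exprn_ge0 _ (ltW l0)) // -natrM -natrX ler_nat -expnD -expnM.
by rewrite leq_exp2l ?muln2 // ltnW.
Qed.

End Growth.

Theorem theorem2 (R : realType) (k : finFieldType)
    (psi : {lrmorphism {poly k} -> tpoly (gammaF k)})
    (Falg : closedFieldType) (iota : {rmorphism {fraction {poly k}} -> Falg}) :
  odd #|k| ->
  is_Drinfeld 2 psi ->
  is_algebraic_closure iota ->
  (forall u : tpoly (iota \o gammaF k),
     Drinfeld_End psi u <-> exists a, u = tpoly_ext iota (psi a)) ->
  exists2 C : R, 0 < C &
    forall (p : {poly k}) (hp : monic_irreducible_poly p),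
      good_reduction psi p ->
      forall d1 d2 : {poly k},
        d1 \is monic -> d2 \is monic -> d1 %| d2 ->
        lmod_isomorphic (Drinfeld_module (reduction psi hp))
          (cyclic_module d1 * cyclic_module d2)%type ->
        C * (poly_abs p)%:R `^ 2^-1
          * (ln (poly_abs p)%:R `^ 2^-1 / ln (ln (poly_abs p)%:R))
        <= (poly_abs d2)%:R.
Proof.
move=> oddk [_ psi0 spsi] _ End_psi.
have q1 : (1 < #|k|)%N := finNzRing_gt1 k.
have q3 : (2 < #|k|)%N by case: #|k| q1 oddk => [|[|[|]]].
pose g1 := (psi 'X)`_1; pose g2 := (psi 'X)`_2.
pose g := frac_den g1 * frac_den g2.
pose G1 := frac_num g1 * frac_den g2; pose G2 := frac_num g2 * frac_den g1.
pose h := (maxn 1 (maxn (size g) (maxn (size G1) (size G2))))%N.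
have h0 : (0 < h)%N by rewrite leq_max.
have sg : (size g <= h)%N by rewrite !leq_max leqnn !orbT.
have sG1 : (size G1 <= h)%N by rewrite !leq_max leqnn !orbT.
have sG2 : (size G2 <= h)%N by rewrite !leq_max leqnn !orbT.
have g0 : g != 0 by rewrite mulf_neq0 ?frac_den_neq0.
have psi1 : gammaF k g * g1 = gammaF k G1.
  by rewrite !rmorphM mulrAC frac_denM.
have psi2 : gammaF k g * g2 = gammaF k G2.
  by rewrite !rmorphM -mulrA frac_denM mulrC.
(* The bound of [endomorphism_bound] is 2 q^2 q^m ((4 + h) m + 6 + 2 h), and the last factor is at
   most (6 + 2 h)(m + 1). *)
pose B := (2 * #|k| ^ 2 * (6 + 2 * h))%N.
have [|C C0 HC] := @growth_bound R #|k| B q3.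
  by rewrite muln_gt0 [X in X && _]muln_gt0 expn_gt0 (ltnW q1).
exists C => // p hp good d1 d2 d1m d2m d12 iso.
have absE (d : {poly k}) : d \is monic -> poly_abs d = (#|k| ^ (size d).-1)%N.
  by move=> dm; rewrite /poly_abs (negPf (monic_neq0 dm)).
rewrite (absE p hp.2) (absE d2 d2m).
have d10 := monic_neq0 d1m; have d20 := monic_neq0 d2m.
have P0 : (0 < (size p).-1)%N by rewrite -ltnS prednK ?hp.1.1 // ltnW // hp.1.1.
have phi0 := reduction_coef0 psi0 hp.
have sphi := size_reductionX spsi hp good.
have le_P : ((size p).-1 <= (size d1).-1 + (size d2).-1)%N.
  by have := card_le_cyclic d10 d20 iso; rewrite residue_field_card leq_exp2l.
have [s [us ss sroot]] := torsion_points d10 d20 d12 iso.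
have [|v [n [vT vN sv nP]]] := frobenius_cofactor phi0 sphi P0
  (@residue_field_expq k p hp) (@residue_ker_size k p hp) (j := (size d1).-1) _ us ss sroot.
  by rewrite prednK // size_poly_gt0.
have [|m [u [a [b [[le_mn uT uN su] [uu sa sb]]]]]] := quadratic_element sphi vT vN (n := n).
  by rewrite sv.
have := endomorphism_bound psi0 spsi (fun w => (End_psi w).1) g0 h0 sg sG1 sG2 psi1 psi2
  phi0 sphi (reduction_coef1 hp good) (reduction_coef2 hp good) (@residue_ker_size k p hp)
  uT uN su uu sa sb.
(* With n = P - 2 deg d1 and P <= deg d1 + deg d2, the sum P + n = 2 (P - deg d1) is at most 2 deg
   d2. *)
have arith P e1 e2 : (n + e1.*2 = P -> P <= e1 + e2 -> P + n <= e2.*2)%N by clear; lia.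
move=> bound; apply: (HC _ n) => //; last exact: arith nP le_P.
apply: leq_trans (ltnW bound) _.
have le_qmn : (#|k| ^ m.+2 <= #|k| ^ 2 * #|k| ^ n)%N.
  by rewrite -expnD leq_exp2l // !addnS.
apply: leq_trans (_ : 2 * ((#|k| ^ 2 * #|k| ^ n) * ((6 + 2 * h) * n.+1)) <= _)%N.
  rewrite leq_mul2l /=; apply: leq_mul => //.
  by clear -le_mn; nia.
by rewrite /B; clear; nia.
Qed.
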